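(* Let $p\geq 3$ be a prime and let $\zeta_{p^2}\in\mathbb{L}_p$ be a root of $\Phi_{p^2}(T)=\sum_{k=0}^{p-1}T^{pk}$ produced by the transfinite Newton algorithm with choices $z_0=1$ and $z_1=\zeta_{2(p-1)}$ (as in the context). For $m\geq1$ let $K_{2,m}=\mathbb{Q}_p(\zeta_{p^2},p^{1/p^m})\subset\mathbb{L}_p$. Then: (1) the element $\pi_{2,1}= \left(p^{\frac{1}{p}}\right)^{-1}\left(\zeta_{p^2}-\sum_{k=0}^{p-1}\frac{1}{[k!]}\zeta_{2(p-1)}^kp^{\frac{k}{p(p-1)}}\right)$ is a uniformizer of $K_{2,1}$; (2) for $m\geq 2$, the element $\pi_{2,m}= \left(p^{\frac{1}{p^m}}\right)^{-\frac{p^m-1}{p-1}}\left(\zeta_{p^2}-\sum_{k=0}^{p-1}\frac{1}{[k!]}\zeta_{2(p-1)}^kp^{\frac{k}{p(p-1)}}-\sum_{l=2}^m \zeta_{2(p-1)}\, p^{\frac{1}{p-1}-\frac{1}{p^l}}\right)$ is a uniformizer of $K_{2,m}$.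
   Context: $\mathbb{L}_p=W(\bar{\mathbb{F}}_p)((p^{\mathbb{Q}}))$ is the $p$-adic Mal'cev–Neumann field: elements are formal sums $\sum_{x\in\mathbb{Q}}[\alpha_x]p^x$ ($\alpha_x\in\bar{\mathbb{F}}_p$, $[\cdot]$ Teichmüller lift) with well-ordered support; it is algebraically closed, complete, contains $\mathbb{Q}_p$, and $v_p(\alpha)=\min$ of the support. For rational $x$, $p^x$ denotes the element with support $\{x\}$ and coefficient $1$. Write $C_x(\alpha)=\alpha_x$. $\zeta_{2(p-1)}$ is a fixed primitive $2(p-1)$-th root of unity in $\bar{\mathbb{F}}_p$, identified with its Teichmüller lift; $[k!]$ is the Teichmüller lift of $k!\bmod p$. Newton polygon of $P(T)=\sum_{k=0}^N a_kT^{N-k}$ ($a_0,a_N\neq0$): lower convex hull of the points $(k,v_p(a_k))$; $m_{\max}$ = largest vertex abscissa $<N$; maximal slope $s_{\max}=\frac{v_p(a_N)-v_p(a_{m_{\max}})}{N-m_{\max}}$; residue polynomial $\mathrm{Res}_P(T)=\sum_{k=0}^{N-m_{\max}}C_{v_p(a_{m_{\max}})+s_{\max}(N-m_{\max}-k)}(a_{N-k})T^k\in\bar{\mathbb{F}}_p[T]$. Transfinite Newton algorithm on a polynomial $f$: start with $r=0$, $\Phi=f$; while $\Phi(0)\neq 0$, let $s$ be the maximal slope of $\mathrm{NP}(\Phi)$, choose a root $c\in\bar{\mathbb{F}}_p$ of $\mathrm{Res}_\Phi$, replace $r$ by $r+[c]p^{s}$ and $\Phi(T)$ by $\Phi(T+[c]p^{s})$;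 the exponents $s$ strictly increase, at limit stages $r$ is the formal sum of all increments so far, and the output $r$ is a root of $f$. Here $z_0,z_1$ denote the roots chosen at the first two steps. *)

(* Defs.v *)
From HB Require Import structures.
From mathcomp Require Import all_boot all_order all_algebra.
From Stdlib Require Import ClassicalEpsilon.
Set Implicit Arguments.
Unset Strict Implicit.
Unset Printing Implicit Defensive.
Import Order.TTheory GRing.Theory Num.Theory.
Local Open Scope ring_scope.

(* An axiomatic presentation of the p-adic Mal'cev--Neumann field
   L_p = W(\bar F_p)((p^Q)) together with its Teichmueller-series data:
   - mnL   : the field L_p (algebraically closed, characteristic 0),
   - mnk   : the residue field \bar F_p (alg. closed, char p, algebraic over F_p),
   - teich : Teichmueller lift [.],
   - ppow x: the element p^x (support {x}, coefficient 1),
   - coef x a : the coefficient C_x(a) = alpha_x of a = sum [alpha_x] p^x.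
   The axioms say: every element has a well-ordered support, elements are in
   bijection with well-ordered-support coefficient functions, monomials
   [c]p^x have the expected expansion, [.] is multiplicative, x |-> p^x is a
   homomorphism with p^1 = p, leading coefficients multiply, and two elements
   whose expansions agree below x differ by an element of valuation >= x
   whose x-coefficient is the difference of the x-coefficients (carries only
   go upward).  L_p with its Teichmueller expansion is a model. *)
Record MNfield (p : nat) := MNField {
  mnL : closedFieldType;
  mnk : closedFieldType;
  teich : mnk -> mnL;
  ppow : rat -> mnL;
  coef : rat -> mnL -> mnk;
  mn_charL : [pchar mnL] =i pred0;
  mn_chark : p \in [pchar mnk];
  mn_kalg : forall c : mnk, exists n : nat, (0 < n)%N /\ c ^+ (p ^ n) = c;
  mn_wo : forall (a : mnL) (P : rat -> Prop),
      (exists x, P x /\ coef x a != 0) ->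
      exists x, [/\ P x, coef x a != 0 &
                    forall y, P y -> coef y a != 0 -> x <= y];
  mn_inj : forall a b : mnL, (forall x, coef x a = coef x b) -> a = b;
  mn_surj : forall f : rat -> mnk,
      (forall P : rat -> Prop, (exists x, P x /\ f x != 0) ->
         exists x, [/\ P x, f x != 0 & forall y, P y -> f y != 0 -> x <= y]) ->
      exists a : mnL, forall x, coef x a = f x;
  mn_mono : forall (c : mnk) (x y : rat),
      coef y (teich c * ppow x) = if y == x then c else 0;
  mn_teichM : forall c d : mnk, teich (c * d) = teich c * teich d;
  mn_ppowD : forall x y : rat, ppow (x + y) = ppow x * ppow y;
  mn_ppow1 : ppow 1 = p%:R;
  mn_mul : forall (a b : mnL) (x y : rat),
      (forall z, z < x -> coef z a = 0) -> (forall z, z < y -> coef z b = 0) ->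
      (forall z, z < x + y -> coef z (a * b) = 0) /\
      coef (x + y) (a * b) = coef x a * coef y b;
  mn_agree : forall (a b : mnL) (x : rat),
      (forall y, y < x -> coef y a = coef y b) ->
      (forall y, y < x -> coef y (a - b) = 0) /\
      coef x (a - b) = coef x a - coef x b
}.

Arguments mnL {p} _.
Unset Implicit Arguments.
Arguments mnk {p} _.
Arguments teich {p} _ _.
Arguments ppow {p} _ _.
Arguments coef {p} _ _ _.


Definition vge {p} (M : MNfield p) (a : mnL M) (x : rat) : Prop :=
  forall y, y < x -> coef M y a = 0.
Definition vgt {p} (M : MNfield p) (a : mnL M) (x : rat) : Prop :=
  forall y, y <= x -> coef M y a = 0.

(* v_p(a) = min of the support (meaningful for a != 0) *)
Definition val {p} (M : MNfield p) (a : mnL M) : rat :=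
  epsilon (inhabits 0)
    (fun x => coef M x a != 0 /\ forall y, y < x -> coef M y a = 0).

Definition trunc {p} (M : MNfield p) (x : rat) (a : mnL M) : mnL M :=
  epsilon (inhabits 0)
    (fun b => forall y, coef M y b = if y < x then coef M y a else 0).

(* Newton polygon of P(T) = sum_{k=0}^N a_k T^(N-k), i.e. a_k = P`_(N-k). *)
Definition np_vertex {p} (M : MNfield p) (P : {poly mnL M}) (k : nat) : Prop :=
  let N := (size P).-1 in
  [/\ (k <= N)%N, P`_(N - k) != 0 &
      exists s : rat, forall j : nat, (j <= N)%N -> j != k -> P`_(N - j) != 0 ->
        val M (P`_(N - k)) + s * ((j%:R : rat) - (k%:R : rat)) < val M (P`_(N - j))].

Definition np_max {p} (M : MNfield p) (P : {poly mnL M}) (m : nat) (s : rat) : Prop :=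
  let N := (size P).-1 in
  [/\ np_vertex M P m, (m < N)%N,
      (forall k, np_vertex M P k -> (k < N)%N -> (k <= m)%N) &
      s = (val M (P`_0) - val M (P`_(N - m))) / ((N - m)%:R)].

Definition res_poly {p} (M : MNfield p) (P : {poly mnL M}) (m : nat) (s : rat)
  : {poly mnk M} :=
  let N := (size P).-1 in
  \poly_(k < (N - m).+1)
     coef M (val M (P`_(N - m)) + s * ((N - m - k)%:R)) (P`_k).

(* r is an output of the transfinite Newton algorithm on f: the steps of the
   run are indexed by the support of r (increments [C_x(r)] p^x, strictly
   increasing exponents); before the step at x the current value is the
   truncation of r below x; at each step Phi(0) != 0, x is the maximal slope
   of NP(Phi) and C_x(r) is a root of Res_Phi; finally f(r) = 0. *)
Definition newton_root {p} (M : MNfield p) (f : {poly mnL M}) (r : mnL M) : Prop :=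
  f.[r] = 0 /\
  forall x : rat, coef M x r != 0 ->
    let Phi := f \Po ('X + (trunc M x r)%:P) in
    Phi.[0] != 0 /\
    exists m : nat, np_max M Phi m x /\ root (res_poly M Phi m x) (coef M x r).

Definition first_two_choices {p} (M : MNfield p) (r : mnL M) (z0 z1 : mnk M) : Prop :=
  exists x0 x1 : rat,
    [/\ x0 < x1, coef M x0 r = z0, coef M x1 r = z1,
        forall y, y < x0 -> coef M y r = 0 &
        forall y, x0 < y -> y < x1 -> coef M y r = 0].

Definition in_Qp {p} (M : MNfield p) (a : mnL M) : Prop :=
  forall n : rat, exists q : rat, vge M (a - ratr q) n.

Definition gen_field {p} (M : MNfield p) (S : mnL M -> Prop) (a : mnL M) : Prop :=
  forall F : mnL M -> Prop,
    (forall x, S x -> F x) -> F 1 ->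
    (forall x y, F x -> F y -> F (x - y)) ->
    (forall x y, F x -> F y -> F (x * y)) ->
    (forall x, F x -> F x^-1) -> F a.

Definition K2 {p} (M : MNfield p) (zeta : mnL M) (m : nat) : mnL M -> Prop :=
  gen_field M (fun x => in_Qp M x \/ x = zeta \/ x = ppow M (1 / (p ^ m)%:R)).

Definition uniformizer {p} (M : MNfield p) (K : mnL M -> Prop) (pi : mnL M) : Prop :=
  [/\ K pi, pi != 0, vgt M pi 0 &
      forall x, K x -> vgt M x 0 -> vge M (x / pi) 0].

Definition cyclo_p2 {p} (M : MNfield p) : {poly mnL M} :=
  \sum_(k < p) 'X^(p * k).

Definition S1 {p} (M : MNfield p) (z : mnk M) : mnL M :=
  \sum_(k < p) (teich M (k`!)%:R)^-1 * teich M z ^+ k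
               * ppow M ((k%:R : rat) / ((p * (p - 1))%:R)).

Definition pi21 {p} (M : MNfield p) (z : mnk M) (zeta : mnL M) : mnL M :=
  (ppow M (1 / (p%:R)))^-1 * (zeta - S1 M z).

Definition pi2m {p} (M : MNfield p) (z : mnk M) (zeta : mnL M) (m : nat) : mnL M :=
  (ppow M (1 / ((p ^ m)%:R))) ^- ((p ^ m - 1) %/ (p - 1)) *
  (zeta - S1 M z
   - \sum_(2 <= l < m.+1) teich M z * ppow M (1 / ((p - 1)%:R) - 1 / ((p ^ l)%:R))).

(* Main.v *)
Require Import Defs.
From HB Require Import structures.
From mathcomp Require Import all_boot all_order all_algebra.
From mathcomp Require Import boolp ring lra zify.
Set Implicit Arguments.
Unset Strict Implicit.
Unset Printing Implicit Defensive.
Import Order.TTheory GRing.Theory Num.Theory.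
Local Open Scope ring_scope.

(* Put r = 1/(p-1), rho = [z] p^(r/p), mu = rho^p (so mu^(p-1) = -p) and
   t_l = [z] p^(r - 1/p^l), so that t_1 = rho and t_(l+1)^p = - p t_l. With E
   the exponential series truncated at degree p-1, E(mu)^p is so close to 1
   that zeta^p = E(mu) up to valuation 1 + r, and E(rho)^p = E(mu) + p rho up
   to the same precision. Hence T_m = S1 + t_2 + ... + t_m satisfies
   T_m^p = zeta^p + p t_m up to valuation 1 + r for every m >= 1, by induction
   on m, and comparing with (T_m + (zeta - T_m))^p gives
   v(zeta - T_m) = r - 1/p^(m+1), i.e. v(pi_(2,m)) = 1/(p^(m+1) (p-1)).
   The uniformizer lies in K_(2,m): (zeta^p - 1)/mu is a 1-unit whose
   (p-1)-st power lies in the complete field Q_p(zeta), so mu lies there too,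
   and the t_l are - mu divided by powers of p^(1/p^m).
   Conversely K_(2,m) has degree at most e = p^(m+1) (p-1) over Q_p, because
   zeta - 1 has degree at most p (p-1) and p^(1/p^m) degree at most p^m, so an
   element with valuation outside (1/e)Z would be linearly independent of
   1, pi, ..., pi^(e-1), which is impossible. *)

(** * Valuations *)

Section Valuation.
Variables (p : nat) (M : MNfield p).
Local Notation L := (mnL M).
Implicit Types (a b c : L) (x y t : rat) (n : nat).

(** Relational form of the valuation: it entails [a != 0], so the arbitrary value of [val] at 0
    never enters. *)
Definition hasval a x : Prop := vge M a x /\ coef M x a != 0.

(** Carries spoil additivity of coefficients in general; at a common lower bound of both supports
    none has occurred yet. *)
Lemma mncoefB a b x : vge M a x -> vge M b x ->
  coef M x (a - b) = coef M x a - coef M x b.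
Proof. by move=> ha hb; apply: (mn_agree _).2 => y yx; rewrite ha // hb. Qed.

Lemma mncoef0 x : coef M x (0 : L) = 0.
Proof. by rewrite -(subrr (0 : L)) (mn_agree (fun y _ => erefl)).2 subrr. Qed.

Lemma vge0 x : vge M 0 x. Proof. by move=> y _; exact: mncoef0. Qed.

Lemma vgeB a b x : vge M a x -> vge M b x -> vge M (a - b) x.
Proof. by move=> ha hb; apply: (mn_agree _).1 => y yx; rewrite ha // hb. Qed.

Lemma vgeN a x : vge M a x -> vge M (- a) x.
Proof. by move=> ha; rewrite -sub0r; apply: vgeB => //; exact: vge0. Qed.

Lemma vgeD a b x : vge M a x -> vge M b x -> vge M (a + b) x.
Proof. by move=> ha hb; rewrite -[b]opprK; apply: vgeB => //; apply: vgeN. Qed.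

Lemma mncoefN a x : vge M a x -> coef M x (- a) = - coef M x a.
Proof. by move=> ha; rewrite -sub0r mncoefB ?mncoef0 ?sub0r //; exact: vge0. Qed.

Lemma mncoefD a b x : vge M a x -> vge M b x ->
  coef M x (a + b) = coef M x a + coef M x b.
Proof.
move=> ha hb; rewrite -[b in LHS]opprK mncoefB //; last exact: vgeN.
by rewrite mncoefN // opprK.
Qed.

Lemma vge_sum (I : Type) (s : seq I) (P : pred I) (F : I -> L) x :
  (forall i, P i -> vge M (F i) x) -> vge M (\sum_(i <- s | P i) F i) x.
Proof.
move=> h; apply: (big_ind (fun a => vge M a x)) => //; first exact: vge0.
by move=> ? ?; exact: vgeD.
Qed.

Lemma mncoef_sum (I : Type) (s : seq I) (P : pred I) (F : I -> L) x :
  (forall i, P i -> vge M (F i) x) ->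
  coef M x (\sum_(i <- s | P i) F i) = \sum_(i <- s | P i) coef M x (F i).
Proof.
move=> h.
suff [] : vge M (\sum_(i <- s | P i) F i) x /\
  coef M x (\sum_(i <- s | P i) F i) = \sum_(i <- s | P i) coef M x (F i) by [].
elim/big_ind2: _ => //.
- by split; [exact: vge0 | exact: mncoef0].
- by move=> a ca b cb [va <-] [vb <-]; split; [exact: vgeD | rewrite mncoefD].
- by move=> i Pi; split => //; apply: h.
Qed.

Lemma vgeM a b x y : vge M a x -> vge M b y -> vge M (a * b) (x + y).
Proof. by move=> ha hb; exact: (mn_mul ha hb).1. Qed.

Lemma mncoefM a b x y : vge M a x -> vge M b y ->
  coef M (x + y) (a * b) = coef M x a * coef M y b.
Proof. by move=> ha hb; exact: (mn_mul ha hb).2. Qed.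

Lemma vgeW a x y : y <= x -> vge M a x -> vge M a y.
Proof. by move=> yx ha w wy; apply: ha; exact: lt_le_trans yx. Qed.

Lemma vgtW a x y : x < y -> vge M a y -> vgt M a x.
Proof. by move=> xy ha w wx; apply: ha; exact: le_lt_trans xy. Qed.

Lemma vgt_vge a x : vgt M a x -> vge M a x.
Proof. by move=> ha w wx; apply: ha; exact: ltW. Qed.

Lemma vge_coef0_vgt a x : vge M a x -> coef M x a = 0 -> vgt M a x.
Proof. by move=> ha hc y; rewrite le_eqVlt => /orP[/eqP->|/ha]. Qed.

Lemma hasval_ex a : a != 0 -> exists x, hasval a x.
Proof.
move=> a0.
have [x hx] : exists x, coef M x a != 0.
  apply: contrapT => h; case/eqP: a0; apply: mn_inj => x; rewrite mncoef0.
  by apply: contrapT => /eqP hx; apply: h; exists x.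
have [|y [_ hy hmin]] := @mn_wo _ M a (fun _ => True); first by exists x.
exists y; split => // w wy; apply: contrapT => /eqP hw.
by have := hmin w I hw; rewrite leNgt wy.
Qed.

Lemma hasval_neq0 a x : hasval a x -> a != 0.
Proof. by move=> [_]; apply: contraNneq => ->; rewrite mncoef0. Qed.

Lemma hasval_vge a x y : hasval a x -> vge M a y -> y <= x.
Proof.
move=> [_ ha] hv; rewrite leNgt; apply/negP => xy.
by move: ha; rewrite hv ?eqxx.
Qed.

Lemma hasval_vgt a x y : hasval a x -> vgt M a y -> y < x.
Proof.
move=> [_ ha] hv; rewrite ltNge; apply/negP => xy.
by move: ha; rewrite hv ?eqxx.
Qed.

Lemma hasval_uniq a x y : hasval a x -> hasval a y -> x = y.
Proof.
by move=> h1 h2; apply/eqP; rewrite eq_le (hasval_vge h1 h2.1) (hasval_vge h2 h1.1).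
Qed.

(** The support has a least element, so a strict bound leaves a definite margin, which later
    estimates amplify. *)
Lemma vgt_ex a x : vgt M a x -> exists2 y, x < y & vge M a y.
Proof.
move=> ha; have [->|/hasval_ex[y hy]] := eqVneq a 0.
  by exists (x + 1); [rewrite ltrDl | exact: vge0].
by exists y; [exact: hasval_vgt ha | case: hy].
Qed.

Lemma vgeP a x : (forall y, hasval a y -> x <= y) -> vge M a x.
Proof.
have [->|/hasval_ex[y hy] h] := eqVneq a 0; first by move=> _; exact: vge0.
by apply: vgeW hy.1; apply: h.
Qed.

Lemma hasvalM a b x y : hasval a x -> hasval b y -> hasval (a * b) (x + y).
Proof.
move=> [ha ca] [hb cb]; split; first exact: vgeM.
by rewrite mncoefM // mulf_neq0.
Qed.

Lemma hasvalN a x : hasval a x -> hasval (- a) x.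
Proof. by move=> [ha ca]; split; [exact: vgeN | rewrite mncoefN // oppr_eq0]. Qed.

Lemma hasvalD a b x : hasval a x -> vgt M b x -> hasval (a + b) x.
Proof.
move=> [ha ca] hb; split; first by apply: vgeD => //; exact: vgt_vge.
by rewrite mncoefD ?(hb x) ?addr0 //; exact: vgt_vge.
Qed.

Lemma lt_bound x : x < (Num.bound `|x|)%:R.
Proof.
exact: le_lt_trans (ler_norm x) (archi_boundP (normr_ge0 x)).
Qed.

Lemma vge_eq0 a : (forall n, vge M a n%:R) -> a = 0.
Proof.
move=> h; apply/eqP; apply: contrapT => /negP /hasval_ex[x hx].
have := hasval_vge hx (h (Num.bound `|x|)).
by rewrite leNgt lt_bound.
Qed.

(** * Powers of p, Teichmueller lifts and integers *)

Lemma ppow_neq0 x : ppow M x != 0.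
Proof.
apply/eqP => h; have := mn_mono (1 : mnk M) x x.
by rewrite h mulr0 mncoef0 eqxx => /esym/eqP; rewrite oner_eq0.
Qed.

Lemma ppow0 : ppow M 0 = 1.
Proof.
have := mn_ppowD M 0 0; rewrite addr0 -{1}[ppow M 0]mulr1.
by move/(mulfI (ppow_neq0 0)).
Qed.

Lemma ppowN x : ppow M (- x) = (ppow M x)^-1.
Proof.
apply: (mulfI (ppow_neq0 x)).
by rewrite -mn_ppowD subrr ppow0 mulfV ?ppow_neq0.
Qed.

Lemma ppowX x n : ppow M x ^+ n = ppow M (x * n%:R).
Proof.
elim: n => [|n IH]; first by rewrite mulr0 ppow0.
by rewrite exprS IH -mn_ppowD -natr1 mulrDr mulr1 addrC.
Qed.

Lemma teich1 : teich M 1 = 1.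
Proof.
have t0 : teich M 1 != 0.
  apply/eqP => h; have := mn_mono (1 : mnk M) 0 0.
  by rewrite h mul0r mncoef0 eqxx => /esym/eqP; rewrite oner_eq0.
by apply: (mulfI t0); rewrite -mn_teichM !mulr1.
Qed.

Lemma teichX (c : mnk M) n : teich M (c ^+ n) = teich M c ^+ n.
Proof. by elim: n => [|n IH]; [exact: teich1 | rewrite !exprS mn_teichM IH]. Qed.

Lemma coef_ppow x y : coef M y (ppow M x) = (y == x)%:R.
Proof. by rewrite -[ppow M x]mul1r -teich1 mn_mono; case: eqP. Qed.

Lemma vge_mono (c : mnk M) x : vge M (teich M c * ppow M x) x.
Proof. by move=> y yx; rewrite mn_mono lt_eqF. Qed.

Lemma hasval_mono (c : mnk M) x : c != 0 -> hasval (teich M c * ppow M x) x.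
Proof. by move=> c0; split; [exact: vge_mono | rewrite mn_mono eqxx]. Qed.

Lemma hasval_ppow x : hasval (ppow M x) x.
Proof. by rewrite -[ppow M x]mul1r -teich1; apply: hasval_mono; exact: oner_neq0. Qed.

Lemma hasval_teich (c : mnk M) : c != 0 -> hasval (teich M c) 0.
Proof. by move=> c0; rewrite -[teich M c]mulr1 -ppow0; exact: hasval_mono. Qed.

Lemma coef0_teich (c : mnk M) : coef M 0 (teich M c) = c.
Proof. by rewrite -[teich M c]mulr1 -ppow0 mn_mono eqxx. Qed.

Lemma vge_teich (c : mnk M) : vge M (teich M c) 0.
Proof. by rewrite -[teich M c]mulr1 -ppow0; exact: vge_mono. Qed.

Lemma mncoef1 y : coef M y (1 : L) = (y == 0)%:R.
Proof. by rewrite -ppow0 coef_ppow. Qed.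

Lemma hasval1 : hasval (1 : L) 0.
Proof. by rewrite -ppow0; exact: hasval_ppow. Qed.

Lemma hasvalX a x n : hasval a x -> hasval (a ^+ n) (x * n%:R).
Proof.
move=> ha; elim: n => [|n IH]; first by rewrite mulr0; exact: hasval1.
by rewrite exprS -natr1 mulrDr mulr1 addrC; exact: hasvalM.
Qed.

Lemma vgeX a x n : vge M a x -> vge M (a ^+ n) (x * n%:R).
Proof.
move=> ha; elim: n => [|n IH]; first by rewrite mulr0; exact: hasval1.1.
by rewrite exprS -natr1 mulrDr mulr1 addrC; exact: vgeM.
Qed.

Lemma hasvalV a x : hasval a x -> hasval a^-1 (- x).
Proof.
move=> ha; have a0 := hasval_neq0 ha.
have [y hy] : exists y, hasval a^-1 y by apply: hasval_ex; rewrite invr_eq0.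
have := hasvalM ha hy; rewrite mulfV // => h.
suff -> : - x = y by [].
by apply/eqP; rewrite eq_sym -subr_eq0 opprK addrC (hasval_uniq h hasval1).
Qed.

Lemma hasval_div a b x y : hasval a x -> hasval b y -> hasval (a / b) (x - y).
Proof. by move=> ha /hasvalV hb; exact: hasvalM. Qed.

Lemma vge_div a b x y : vge M a x -> hasval b y -> vge M (a / b) (x - y).
Proof. by move=> ha /hasvalV[hb _]; exact: vgeM. Qed.

Lemma vge_nat n : vge M (n%:R : L) 0.
Proof.
elim: n => [|n IH]; first exact: vge0.
by rewrite -natr1; apply: vgeD => //; exact: hasval1.1.
Qed.

Lemma coef0_nat n : coef M 0 (n%:R : L) = n%:R.
Proof.
elim: n => [|n IH]; first exact: mncoef0.
rewrite -!natr1 mncoefD ?IH ?mncoef1 ?eqxx //; [exact: vge_nat | exact: hasval1.1].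
Qed.

Lemma hasval_p : hasval (p%:R : L) 1.
Proof. by rewrite -mn_ppow1; exact: hasval_ppow. Qed.

Lemma mn_prime : prime p.
Proof. by have := mn_chark M; rewrite inE => /andP[]. Qed.

Lemma natr_eq0 n : (n%:R == 0 :> mnk M) = (p %| n)%N.
Proof. by rewrite (dvdn_pcharf (mn_chark M)). Qed.

Lemma hasval_nat_coprime n : ~~ (p %| n)%N -> hasval (n%:R : L) 0.
Proof. by move=> h; split; [exact: vge_nat | rewrite coef0_nat natr_eq0]. Qed.

Lemma natL_eq0 n : ((n%:R : L) == 0) = (n == 0)%N.
Proof. by move: n; apply/pcharf0P; exact: mn_charL. Qed.

(** Converse of [mn_agree]: at the least exponent where the expansions differ, [mn_agree] computes a
    nonzero coefficient of [a - b]. *)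
Lemma vge_agree a b x : vge M (a - b) x ->
  forall y, y < x -> coef M y a = coef M y b.
Proof.
move=> hv y yx; apply: contrapT => hy.
pose P w := coef M w a <> coef M w b.
have agree w : (forall v, v < w -> coef M v a = coef M v b) -> P w -> x <= w.
  move=> hw hP; rewrite leNgt; apply/negP => wx; apply: hP.
  by apply/eqP; rewrite -subr_eq0 -((mn_agree hw).2) hv.
suff [w [wy Pw hw]] : exists w, [/\ w <= y, P w & forall v, P v -> w <= v].
  have /agree /(_ Pw) : forall v, v < w -> coef M v a = coef M v b.
    move=> v vw; apply: contrapT => /hw; by rewrite leNgt vw.
  by rewrite leNgt (le_lt_trans wy yx).
(* An exponent of disagreement lies in the support of [a] or of [b]; both are well ordered, and the
   smaller of the two minima is the exponent sought. *)
have minof c : (exists w, P w /\ coef M w c != 0) \/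
    (forall w, P w -> coef M w c = 0).
  have [|h] := EM (exists w, P w /\ coef M w c != 0); [by left | right].
  move=> w Pw; apply: contrapT => /eqP hw; by apply: h; exists w.
have PE w : P w -> coef M w a = 0 -> coef M w b = 0 -> False.
  by move=> + h1 h2; rewrite /P h1 h2.
have [/mn_wo[wa [Pa ca ha]]|ha] := minof a;
  have [/mn_wo[wb [Pb cb hb]]|hb] := minof b.
- exists (Num.min wa wb); split.
  + rewrite ge_min; have [h|/ha->//] := eqVneq (coef M y a) 0.
    have [h'|/hb->//] := eqVneq (coef M y b) 0; last by rewrite orbT.
    by case: (PE y hy h h').
  + by case: (leP wa wb).
  + move=> v Pv; rewrite ge_min; have [h|/ha->//] := eqVneq (coef M v a) 0.
    have [h'|/hb->//] := eqVneq (coef M v b) 0; last by rewrite orbT.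
    by case: (PE v Pv h h').
- have g v : P v -> wa <= v.
    move=> Pv; apply: ha => //; apply/eqP => h; exact: (PE v Pv h (hb v Pv)).
  by exists wa; split => //; exact: g.
- have g v : P v -> wb <= v.
    move=> Pv; apply: hb => //; apply/eqP => h; exact: (PE v Pv (ha v Pv) h).
  by exists wb; split => //; exact: g.
- by case: (PE y hy (ha y hy) (hb y hy)).
Qed.

(** Below [i] the expansions of all [u j] with [j >= i] agree, so the limit is built
    coefficientwise: at [x] it takes the coefficient of any term of index above [x]. *)
Lemma mn_complete (u : nat -> L) :
  (forall i j, (i <= j)%N -> vge M (u i - u j) i%:R) ->
  exists a, forall i, vge M (u i - a) i%:R.
Proof.
move=> cu; pose idx x := Num.bound `|x|.
have idxP x : x < (idx x)%:R := lt_bound x.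
pose f x := coef M x (u (idx x)).
have fE i x : x < i%:R -> f x = coef M x (u i).
  move=> xi; have [h|h] := leqP (idx x) i.
    exact: (vge_agree (cu _ _ h)).
  exact/esym/(vge_agree (cu _ _ (ltnW h))).
have [|a ha] := @mn_surj _ M f.
  (* On exponents at most [x], [f] coincides with the expansion of the single term [u (idx x)],
     whose support is well ordered. *)
  move=> P [x [Px fx]].
  have [|y [[Py yx] cy hy]] := @mn_wo _ M (u (idx x)) (fun y => P y /\ y <= x).
    by exists x.
  have yi : y < (idx x)%:R by exact: le_lt_trans (idxP x).
  exists y; split => //; first by rewrite (fE (idx x)).
  move=> w Pw fw; have [wx|/ltW xw] := leP w x; last exact: le_trans xw.
  by apply: hy => //; rewrite -(fE (idx x)) // (le_lt_trans wx).
by exists a => i; apply: (mn_agree _).1 => y yi; rewrite ha (fE i).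
Qed.

End Valuation.

(** * The valuation ring and the truncated exponential *)

(** The inner binomial coefficients are divisible by [p]. The cross term linear in [b] is kept
    apart, since it dominates when [a] is a unit and [b] is small. The subring [S] covers both the
    valuation ring and polynomials over it. *)
Lemma exprD_prime (R : comNzRingType) (S : subringClosed R) (p : nat) (a b : R) :
  prime p -> a \in S -> b \in S ->
  exists2 g, g \in S &
    (a + b) ^+ p = a ^+ p + b ^+ p + p%:R * a * b * (a ^+ (p - 2) + b * g).
Proof.
case: p => [|[|n]] // pr_p aS bS.
(* With [p = n.+2], [c i] is the binomial coefficient of index [i.+2] divided by [p]. *)
pose c i := ('C(n.+2, i.+2) %/ n.+2)%N.
exists (\sum_(i < n) (c i)%:R * a ^+ (n - i.+1) * b ^+ i).
  by apply: rpred_sum => i _; rewrite !rpredM ?rpredX ?rpred_nat.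
rewrite exprDn big_ord_recl big_ord_recl big_ord_recr /= /bump /= !add1n.
rewrite subn0 expr0 mulr1 bin0 mulr1n subnn expr0 mul1r binn mulr1n.
rewrite !subSS subn0 expr1 bin1.
have -> : \sum_(i < n) a ^+ (n.+2 - i.+2) * b ^+ i.+2 *+ 'C(n.+2, i.+2)
  = n.+2%:R * a * b * b * \sum_(i < n) (c i)%:R * a ^+ (n - i.+1) * b ^+ i.
  rewrite mulr_sumr; apply: eq_bigr => i _.
  have -> : 'C(n.+2, i.+2) = (n.+2 * c i)%N.
    by rewrite mulnC divnK // prime_dvd_bin //= !ltnS.
  have -> : (n.+2 - i.+2 = (n - i.+1).+1)%N by rewrite !subSS subnSK.
  rewrite -mulr_natr natrM !exprS.
  by move: (c i)%:R n.+2%:R (a ^+ _) (b ^+ _) => *; ring.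
rewrite subn0 [a ^+ n.+1]exprS -mulr_natr.
by move: (\sum_(i < n) _) (n.+2%:R) (a ^+ n.+2) (b ^+ n.+2) (a ^+ n) => *; ring.
Qed.

Lemma expr_sum_prime (R : comNzRingType) (S : subringClosed R) (p : nat)
    (n : nat) (F : nat -> R) : prime p -> (forall i, F i \in S) ->
  exists2 g, g \in S &
    (\sum_(i < n) F i) ^+ p = \sum_(i < n) F i ^+ p + p%:R * g.
Proof.
move=> pr_p FS; elim: n => [|n [g gS IH]].
  exists 0; first exact: rpred0.
  by rewrite !big_ord0 expr0n mulr0 addr0 eqn0Ngt prime_gt0.
have sS : \sum_(i < n) F i \in S by exact: rpred_sum.
have [h hS eh] := exprD_prime pr_p sS (FS n).
rewrite !big_ord_recr /= eh IH; set s := \sum_(i < n) F i in sS *.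
exists (g + s * F n * (s ^+ (p - 2) + F n * h)); last by ring.
by rewrite !(rpredD, rpredM, rpredX).
Qed.

Lemma prime_dvdn_fact p n : prime p -> (p %| n`!)%N = (p <= n)%N.
Proof.
move=> pr_p; elim: n => [|n IH].
  by rewrite fact0 dvdn1 leqn0; case: p pr_p => [|[]].
rewrite factS Euclid_dvdM // IH [RHS]leq_eqVlt ltnS.
have [->|ne] := eqVneq p n.+1; first by rewrite dvdnn.
have [_|np] := leqP p n; first by rewrite orbT.
by rewrite orbF; apply: gtnNdvd => //; rewrite ltn_neqAle eq_sym ne.
Qed.

Section Integers.
Variables (p : nat) (M : MNfield p).
Local Notation L := (mnL M).
Implicit Types (a b c : L) (x y t : rat) (n : nat).

Definition val_ring : {pred L} := fun a => `[< vge M a 0 >].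

Lemma val_ringP a : reflect (vge M a 0) (a \in val_ring).
Proof. exact: asboolP. Qed.

Lemma val_ring_closed : subring_closed val_ring.
Proof.
split.
- by apply/val_ringP; exact: (hasval1 M).1.
- by move=> a b /val_ringP ha /val_ringP hb; apply/val_ringP/vgeB.
- move=> a b /val_ringP ha /val_ringP hb; apply/val_ringP.
  by rewrite -(addr0 (0 : rat)); exact: vgeM.
Qed.

HB.instance Definition _ := GRing.isSubringClosed.Build L val_ring val_ring_closed.

Lemma vge_exprD a b : vge M a 0 -> vge M b 0 ->
  exists2 g, vge M g 0 &
    (a + b) ^+ p = a ^+ p + b ^+ p + p%:R * a * b * (a ^+ (p - 2) + b * g).
Proof.
move=> /val_ringP ha /val_ringP hb.
by have [g /val_ringP gS e] := exprD_prime (mn_prime M) ha hb; exists g.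
Qed.

Lemma hasval_fact n : (n < p)%N -> hasval (n`!%:R : L) 0.
Proof.
by move=> np; apply: hasval_nat_coprime; rewrite prime_dvdn_fact ?(mn_prime M) // -ltnNge.
Qed.

Definition exp_trunc : {poly L} := \poly_(k < p) (k`!%:R)^-1.

Lemma hasval_invfact n : (n < p)%N -> hasval ((n`!%:R : L)^-1) 0.
Proof. by move=> /hasval_fact/hasvalV; rewrite oppr0. Qed.

Lemma fact_unit n : (n`!%:R : L) != 0.
Proof. by rewrite natL_eq0 -lt0n fact_gt0. Qed.

Lemma deriv_exp_trunc :
  exp_trunc^`() = exp_trunc - ((p.-1)`!%:R)^-1 *: 'X^(p.-1).
Proof.
have p0 := prime_gt0 (mn_prime M).
apply/polyP => i; rewrite coef_deriv coefB !coef_poly coefZ coefXn.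
have [h|h] := ltnP i.+1 p.
  rewrite (ltn_trans (ltnSn i) h) [i == _]ltn_eqF ?mulr0 ?subr0; last by lia.
  rewrite factS natrM invfM -[_ *+ _]mulr_natr mulrAC mulVf ?mul1r //.
  by rewrite natL_eq0.
rewrite mul0rn; have [ip|ip] := ltnP i p.
  have -> : i = p.-1 by lia.
  by rewrite eqxx mulr1 subrr.
by rewrite [i == _]gtn_eqF ?mulr0 ?subr0 //; lia.
Qed.

(* Away from degree p-1 the truncated exponential satisfies E' = E, so the
   low coefficients of E^p satisfy the recursion of those of exp(pX). *)
Lemma coef_exp_trunc_expr i : (i < p)%N ->
  (exp_trunc ^+ p)`_i = p%:R ^+ i / i`!%:R.
Proof.
have p0 := prime_gt0 (mn_prime M).
elim: i => [_|i IH ip].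
  rewrite -horner_coef0 horner_exp horner_coef0 coef_poly p0 fact0 invr1 expr1n.
  by rewrite expr0 mulr1.
have i0 : (i.+1%:R : L) != 0 by rewrite natL_eq0.
apply: (mulIf i0); rewrite [LHS]mulr_natr -coef_deriv deriv_exp deriv_exp_trunc.
rewrite mulrBl -exprS prednK // mulrnBl coefB !coefMn -scalerAl coefZ coefXnM.
have -> : (i < p.-1)%N by lia.
rewrite mulr0 mul0rn subr0 IH; last by lia.
rewrite factS natrM -mulr_natr exprSr; field.
by rewrite fact_unit addrC natr1 i0.
Qed.

Lemma horner_exp_trunc a : exp_trunc.[a] = \sum_(k < p) a ^+ k / k`!%:R.
Proof.
rewrite horner_poly; apply: eq_bigr => k _; exact: mulrC.
Qed.

(** Write [exp_trunc ^+ p] as the sum of the [p]-th powers of its terms plus [p * Q] with [Q]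
    integral. The known low coefficients show that [Q - 'X] has no term of degree below 2 and a
    further factor [p] in degrees 2 to [p - 1]; in degrees from [p] on, [a ^+ i] alone has valuation
    at least [p * t]. *)
Lemma exp_trunc_expr a t : vge M a t -> 0 <= t -> p%:R * t <= 1 + t ->
  vge M (exp_trunc.[a] ^+ p - \sum_(k < p) (a ^+ k / k`!%:R) ^+ p - p%:R * a)
    (1 + p%:R * t).
Proof.
move=> ha t0 pt; have pr_p := mn_prime M; have p0 := prime_gt0 pr_p.
have pL : (p%:R : L) != 0 by exact: hasval_neq0 (hasval_p M).
pose F k : {poly L} := if (k < p)%N then (k`!%:R)^-1 *: 'X^k else 0.
have FS k : F k \is a polyOver val_ring.
  rewrite /F; case: ifP => [kp|_]; last exact: rpred0.
  by rewrite polyOverZ ?rpredX ?polyOverX //; apply/val_ringP; case: (hasval_invfact kp).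
have FE : exp_trunc = \sum_(k < p) F k.
  by rewrite /exp_trunc poly_def; apply: eq_bigr => k _; rewrite /F ltn_ord.
have [Q /polyOverP QS EQ] := expr_sum_prime p pr_p FS.
rewrite -FE in EQ.
have FpE (k : 'I_p) : F k ^+ p = ((k`!%:R)^-1) ^+ p *: 'X^(k * p).
  by rewrite /F ltn_ord exprZn exprM.
(* Below degree [p] the sum of [p]-th powers contributes only its constant term 1. *)
have Qlow i : (i < p)%N -> p%:R * Q`_i = p%:R ^+ i / i`!%:R - (i == 0%N)%:R.
  move=> ip; have := coef_exp_trunc_expr ip.
  rewrite EQ coefD -polyC_natr coefCM coef_sum.
  rewrite (bigD1 (Ordinal p0)) // big1 ?addr0 => [|k k0].
    rewrite FpE /= mul0n expr0 coefZ coef1 fact0 invr1 expr1n mul1r => <-.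
    by rewrite addr0 [X in _ = X - _]addrC addrK.
  rewrite FpE coefZ coefXn [i == _]ltn_eqF ?mulr0 //.
  by rewrite (leq_trans ip) // leq_pmull // lt0n.
have -> : exp_trunc.[a] ^+ p - \sum_(k < p) (a ^+ k / k`!%:R) ^+ p - p%:R * a
    = p%:R * (Q - 'X).[a].
  rewrite -horner_exp EQ !hornerD hornerM hornerN hornerX horner_sum -polyC_natr hornerC.
  have -> : \sum_(k < p) (F k ^+ p).[a] = \sum_(k < p) (a ^+ k / k`!%:R) ^+ p.
    by apply: eq_bigr => k _; rewrite FpE hornerZ hornerXn exprMn mulrC -exprM.
  by ring.
apply: vgeM; first exact: (hasval_p M).1.
rewrite horner_coef; apply: vge_sum => i _; rewrite coefB coefX.
move: (nat_of_ord i) => {}i.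
have iX := @vgeX _ _ _ _ i ha.
have [ip|pi] := ltnP i p; last first.
  rewrite [_ == 1%N]gtn_eqF ?subr0; last by have := prime_gt1 pr_p; lia.
  rewrite -[p%:R * t]add0r; apply: vgeM; first exact/val_ringP.
  by apply: vgeW iX; rewrite mulrC ler_wpM2l // ler_nat.
have pQ := Qlow i ip; have [i1|i2] := leqP i 1.
  have -> : Q`_i - (i == 1%N)%:R = 0.
    apply: (mulfI pL); rewrite mulrBr pQ mulr0.
    case: i i1 {ip iX pQ} => [|[|//]] _ /=.
      by rewrite fact0 expr0 divr1 mulr0 !subrr.
    by rewrite factS fact0 expr1 divr1 mulr1 subr0 subrr.
  by rewrite mul0r; exact: vge0.
rewrite [_ == 1%N]gtn_eqF // subr0.
have -> : Q`_i = p%:R * (p%:R ^+ (i - 2) / i`!%:R).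
  apply: (mulfI pL); rewrite pQ gtn_eqF ?subr0; last by lia.
  by rewrite -{1}(subnK i2) exprD expr2; move: (p%:R ^+ _) (_^-1) => *; ring.
(* The extra factor [p] gives valuation [1 + t * i >= 1 + t], which is at least [p * t] by
   hypothesis. *)
apply: (@vgeW _ _ _ (1 + (0 + 0) + t * i%:R)).
  apply: le_trans pt _; rewrite !addr0 lerD2l -[X in X <= _]mulr1 ler_wpM2l //.
  by rewrite ler1n; lia.
apply: vgeM => //; apply: vgeM; first exact: (hasval_p M).1.
apply: vgeM; last exact: (hasval_invfact ip).1.
by apply/val_ringP; rewrite rpredX // rpred_nat.
Qed.

End Integers.

(** * p-adic numbers *)

Section PadicNumbers.
Variables (p : nat) (M : MNfield p).
Local Notation L := (mnL M).
Implicit Types (a b c : L) (x y t : rat) (n : nat).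

(** Rational numbers of [L] as integer fractions, on which closure under field operations is a
    computation; [isratP] links them to [ratr]. *)
Definition israt a := exists i j : int, j != 0 /\ a = i%:~R / j%:~R.

Lemma intL_eq0 (i : int) : ((i%:~R : L) == 0) = (i == 0).
Proof. by case: i => n; rewrite ?NegzE ?mulrNz ?oppr_eq0 -pmulrn natL_eq0. Qed.

Lemma isratP a : israt a <-> exists q : rat, a = ratr q.
Proof.
split=> [[i [j [j0 ->]]]|[q ->]]; last first.
  by exists (numq q), (denq q); split; rewrite ?denq_neq0.
exists (i%:~R / j%:~R); rewrite /ratr; set q := _ / _ : rat.
have dq := denq_neq0 q.
have e : (i * denq q = numq q * j)%R.
  apply: (@intr_inj rat); rewrite !rmorphM /=.
  have /eqP := divq_num_den q; rewrite eq_sym {1}/q eqr_div ?intr_eq0 //.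
  by move/eqP.
by apply/eqP; rewrite eqr_div ?intL_eq0 // -!rmorphM e.
Qed.

Lemma israt_int (i : int) : israt i%:~R.
Proof. by exists i, 1; rewrite divr1. Qed.

Lemma israt_nat n : israt n%:R.
Proof. exact: (israt_int n). Qed.

Lemma isratB a b : israt a -> israt b -> israt (a - b).
Proof.
move=> [i [j [j0 ->]]] [k [l [l0 ->]]]; exists (i * l - k * j), (j * l).
rewrite mulf_neq0 //; split => //; rewrite rmorphB !rmorphM /=; field.
by rewrite !intL_eq0 j0 l0.
Qed.

Lemma isratM a b : israt a -> israt b -> israt (a * b).
Proof.
move=> [i [j [j0 ->]]] [k [l [l0 ->]]]; exists (i * k), (j * l).
rewrite mulf_neq0 //; split => //; rewrite !rmorphM /=; field.
by rewrite !intL_eq0 j0 l0.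
Qed.

Lemma isratV a : israt a -> israt a^-1.
Proof.
move=> [i [j [j0 ->]]]; have [->|i0] := eqVneq i 0.
  by rewrite mul0r invr0; exact: (israt_int 0).
by exists j, i; rewrite invf_div.
Qed.

Lemma isratX a n : israt a -> israt (a ^+ n).
Proof.
move=> ha; elim: n => [|n IH]; first exact: (israt_int 1).
by rewrite exprS; exact: isratM.
Qed.

Lemma hasval_nat n : (0 < n)%N -> hasval (n%:R : L) (logn p n)%:R.
Proof.
move=> n0; have pr_p := mn_prime M.
have [m cm {1}->] := pfactor_coprime pr_p n0.
rewrite natrM natrX -[X in hasval _ X]add0r; apply: hasvalM.
  by apply: hasval_nat_coprime; rewrite -prime_coprime.
by rewrite -[X in hasval _ X]mul1r; apply: hasvalX; exact: hasval_p.
Qed.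

Lemma israt_val_int a x : israt a -> hasval a x -> x \is a Num.int.
Proof.
have hint (i : int) : i != 0 -> exists n, hasval (i%:~R : L) n%:R.
  move=> i0; exists (logn p `|i|); case: i i0 => n i0.
    by rewrite -pmulrn; apply: hasval_nat; rewrite lt0n.
  by rewrite NegzE mulrNz -pmulrn; apply: hasvalN; apply: hasval_nat.
move=> [i [j [j0 ->]]] hx.
have i0 : i != 0.
  by apply: contraTneq (hasval_neq0 hx) => ->; rewrite mul0r eqxx.
have [n hn] := hint _ i0; have [m hm] := hint _ j0.
by rewrite (hasval_uniq hx (hasval_div hn hm)) rpredB ?rpred_nat.
Qed.

Lemma in_QpE a : in_Qp M a <-> forall t, exists2 b, israt b & vge M (a - b) t.
Proof.
split=> h t.
  by have [q hq] := h t; exists (ratr q) => //; apply/isratP; exists q.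
by have [b /isratP[q ->] hb] := h t; exists q.
Qed.

Lemma in_Qp_rat a : israt a -> in_Qp M a.
Proof. by move=> ha; apply/in_QpE => t; exists a => //; rewrite subrr; exact: vge0. Qed.

Lemma in_Qp_approx a x t : in_Qp M a -> hasval a x ->
  exists b, [/\ israt b, hasval b x & vge M (a - b) t].
Proof.
(* Precision [x + 1] keeps the error above the valuation of [a], so the approximation has the same
   valuation. *)
move=> /in_QpE ha hx; have [b rb hb] := ha (Num.max t (x + 1)).
exists b; split => //; last by apply: vgeW hb; rewrite le_max lexx.
rewrite -[b](subKr a); apply: hasvalD => //.
apply: vgtW (vgeN hb); by rewrite lt_max ltrDl ltr01 orbT.
Qed.

Lemma in_Qp_val_int a x : in_Qp M a -> hasval a x -> x \is a Num.int.
Proof.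
move=> ha hx; have [b [rb hb _]] := in_Qp_approx 0 ha hx.
exact: israt_val_int rb hb.
Qed.

Lemma in_QpB a b : in_Qp M a -> in_Qp M b -> in_Qp M (a - b).
Proof.
move=> /in_QpE ha /in_QpE hb; apply/in_QpE => t.
have [c rc hc] := ha t; have [d rd hd] := hb t.
exists (c - d); first exact: isratB.
have -> : a - b - (c - d) = (a - c) - (b - d) by ring.
exact: vgeB.
Qed.

Lemma in_QpM a b : in_Qp M a -> in_Qp M b -> in_Qp M (a * b).
Proof.
have [->|/hasval_ex[x hx]] := eqVneq a 0; first by rewrite mul0r.
have [->|/hasval_ex[y hy]] := eqVneq b 0; first by rewrite mulr0.
move=> ha hb; apply/in_QpE => t.
have [c [rc hc ac]] := in_Qp_approx (t - y) ha hx.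
have [d [rd hd bd]] := in_Qp_approx (t - x) hb hy.
exists (c * d); first exact: isratM.
have -> : a * b - c * d = (a - c) * b + c * (b - d) by ring.
apply: vgeD.
  by rewrite -(subrK y t); apply: vgeM => //; case: hy.
by rewrite -(subrK x t) [_ + x]addrC; apply: vgeM => //; case: hc.
Qed.

Lemma in_QpV a : in_Qp M a -> in_Qp M a^-1.
Proof.
have [->|/hasval_ex[x hx]] := eqVneq a 0; first by rewrite invr0.
move=> ha; apply/in_QpE => t.
have [c [rc hc ac]] := in_Qp_approx (t + (x + x)) ha hx.
exists c^-1; first exact: isratV.
have -> : a^-1 - c^-1 = - (a - c) / (a * c).
  by field; rewrite (hasval_neq0 hx) (hasval_neq0 hc).
rewrite -(addrK (x + x) t); apply: vge_div; first exact: vgeN.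
exact: hasvalM.
Qed.

Definition Qp_pred : {pred L} := fun a => `[< in_Qp M a >].

Lemma Qp_predP a : reflect (in_Qp M a) (a \in Qp_pred).
Proof. exact: asboolP. Qed.

Lemma Qp_pred_closed : divring_closed Qp_pred.
Proof.
split=> [|a b|a b]; rewrite ?inE.
- by apply/Qp_predP/in_Qp_rat/(israt_int 1).
- by move=> /Qp_predP ha /Qp_predP hb; apply/Qp_predP/in_QpB.
- by move=> /Qp_predP ha /Qp_predP hb; apply/Qp_predP/in_QpM => //; exact: in_QpV.
Qed.

HB.instance Definition _ := GRing.isDivringClosed.Build L Qp_pred Qp_pred_closed.

(** As a field type of its own, Q_p can supply the scalars of matrices and polynomials. *)
Definition Qp := {a : L | a \in Qp_pred}.
HB.instance Definition _ := SubType.on Qp.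
HB.instance Definition _ := Choice.on Qp.
HB.instance Definition _ := [SubChoice_isSubIntegralDomain of Qp by <:].
HB.instance Definition _ := [SubIntegralDomain_isSubField of Qp by <:].

Definition Qp_val : {rmorphism Qp -> L} := \val.

Lemma iota_in (u : Qp) : in_Qp M (Qp_val u).
Proof. by apply/Qp_predP; exact: (valP u). Qed.

Lemma in_Qp_iota a : in_Qp M a -> exists u : Qp, Qp_val u = a.
Proof. by move=> /Qp_predP ha; exists (Sub a ha). Qed.

(** Write [b] as [a + (b - a)]: the cross terms gain a factor [p], and the pure power multiplies the
    precision by [p]. *)
Lemma vge_frob a b t : vge M a 0 -> vge M (b - a) t -> 0 <= t ->
  vge M (b ^+ p - a ^+ p) (Num.min (1 + t) (t * p%:R)).
Proof.
move=> ha hb t0; have [g hg] := vge_exprD ha (vgeW t0 hb).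
rewrite addrCA subrr addr0 => ->.
rewrite -[X in X - _]addrA [X in X - _]addrC addrK; apply: vgeD.
  by apply: vgeW (@vgeX _ _ _ _ p hb); rewrite ge_min lexx orbT.
have hh : vge M (a ^+ (p - 2) + (b - a) * g) 0.
  by apply/val_ringP; rewrite rpredD ?rpredX ?rpredM //; apply/val_ringP => //; exact: vgeW hb.
apply: (@vgeW _ _ _ (1 + 0 + t + 0)); first by rewrite ge_min !addr0 lexx.
by apply: vgeM => //; apply: vgeM => //; apply: vgeM => //; exact: (hasval_p M).1.
Qed.

(** The lift is the limit of the integers [n ^+ (p ^ N)], hence lies in Q_p. Its difference with
    [n], if nonzero, has positive valuation, which is integral in Q_p and so at least 1. *)
Lemma teich_nat n : in_Qp M (teich M n%:R) /\ vge M (teich M n%:R - n%:R) 1.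
Proof.
set b := teich M n%:R; set a : L := n%:R.
have bp : b ^+ p = b.
  by rewrite -teichX -(pFrobenius_autE (mn_chark M)) rmorph_nat.
have vb : vge M b 0 := vge_teich _.
have : vgt M (a - b) 0.
  apply: vge_coef0_vgt; first by apply: vgeB => //; exact: vge_nat.
  by rewrite mncoefB ?coef0_nat ?coef0_teich ?subrr //; exact: vge_nat.
(* With the margin [x] capped at 1, each [p]-th power gains [x]: both [1 + t] and [t * p] are at
   least [t + x] once [t >= x]. *)
move=> /vgt_ex[x1 x10 hx1]; pose x := Num.min x1 1.
have x0 : 0 < x by rewrite lt_min x10.
have hx : vge M (a - b) x by apply: vgeW hx1; rewrite ge_min lexx.
have step N : vge M (a ^+ (p ^ N) - b) (x * N.+1%:R).
  elim: N => [|N IH]; first by rewrite mulr1 expn0 expr1.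
  rewrite expnSr exprM -{1}bp; apply: vgeW (vge_frob vb IH _); last first.
    by rewrite mulr_ge0 // ltW.
  have xN : x * N.+2%:R = x * N.+1%:R + x by rewrite -[N.+2%:R]natr1; ring.
  rewrite le_min xN; apply/andP; split.
    by rewrite addrC lerD2r ge_min lexx orbT.
  apply: (@le_trans _ _ (x * N.+1%:R + x * N.+1%:R)).
    by rewrite lerD2l -[X in X <= _]mulr1 ler_wpM2l ?(ltW x0) // ler1n.
  rewrite -mulr2n -[X in X <= _]mulr_natr.
  by rewrite ler_wpM2l ?mulr_ge0 ?(ltW x0) // ler_nat (prime_gt1 (mn_prime M)).
have bQ : in_Qp M b.
  apply/in_QpE => t; pose N := Num.bound `|t / x|.
  exists (a ^+ (p ^ N)); first by apply: isratX; exact: israt_nat.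
  rewrite -opprB; apply: vgeN; apply: vgeW (step N).
  rewrite mulrC -ler_pdivrMr //; apply: le_trans (ltW (lt_bound _)) _.
  by rewrite ler_nat.
split => //; apply: vgeP => y hy.
have : y \is a Num.int.
  by apply: in_Qp_val_int hy; apply: in_QpB => //; apply: in_Qp_rat; exact: israt_nat.
have : 0 < y by apply: lt_le_trans x0 (hasval_vge hy _); rewrite -opprB; exact: vgeN.
by move=> y0 /intrP[[k|k] yk]; move: y0; rewrite yk ?ltr0z ?ler1z.
Qed.

End PadicNumbers.

(** * Expansion of the root of unity *)

Section RootsOfUnity.
Variables (p : nat) (M : MNfield p).
Hypothesis p_gt2 : (2 < p)%N.
Local Notation L := (mnL M).
Local Notation P := (p%:R : rat).
Implicit Types (a b c : L) (x y t : rat) (n : nat).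

(** The valuation of [zeta_p - 1] for a primitive [p]-th root of unity [zeta_p]; it is the threshold
    where taking [p]-th powers and multiplying by [p] affect valuations equally. *)
Definition vlam : rat := 1 / (p - 1)%:R.
Local Notation r := vlam.

Lemma P_ge3 : 3 <= P. Proof. by rewrite ler_nat. Qed.

Lemma predP : (p - 1)%:R = P - 1.
Proof. by rewrite natrB // ltnW // ltnW. Qed.

Lemma vlamE : P * r = 1 + r.
Proof. by rewrite /r predP; field; have := P_ge3; lra. Qed.

Lemma vlam_gt0 : 0 < r.
Proof. by rewrite /r predP divr_gt0 //; have := P_ge3; lra. Qed.

Lemma vlam_le : 2 * r <= 1.
Proof.
have := vlamE; have := P_ge3; have := vlam_gt0; set s := r => s0 P3 e.
have : 3 * s <= P * s by rewrite ler_wpM2r // ltW.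
lra.
Qed.

Lemma vlamP : (r / P) * P = r.
Proof. by rewrite divfK //; have := P_ge3; lra. Qed.

Lemma vlamP_gt0 : 0 < r / P.
Proof. by rewrite divr_gt0 ?vlam_gt0 //; have := P_ge3; lra. Qed.

Lemma hasval_unity_root a n : (0 < n)%N -> a ^+ n = 1 -> hasval a 0.
Proof.
move=> n0 an; have a0 : a != 0.
  by apply/eqP => a0; move: an; rewrite a0 expr0n gtn_eqF // => /esym/eqP; rewrite oner_eq0.
have [x hx] := hasval_ex a0; have := hasvalX n hx.
rewrite an => /(hasval_uniq (hasval1 M)) /esym /eqP.
by rewrite mulf_eq0 pnatr_eq0 (gtn_eqF n0) orbF => /eqP x0; rewrite x0 in hx.
Qed.

(** Expanding [(1 + l) ^+ p = 1] and dividing by [l] leaves [l ^+ p.-1 = - (p * (1 + l * g))], and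
    the last factor is a unit once [l] has positive valuation. *)
Lemma hasval_unity_root_sub1 a : a ^+ p = 1 -> a != 1 -> hasval (a - 1) r.
Proof.
move=> ap a1; pose l := a - 1.
have p0 : (0 < p)%N by lia.
have vl : vge M l 0.
  by apply: vgeB; [exact: (hasval_unity_root p0 ap).1 | exact: (hasval1 M).1].
have l0 : l != 0 by rewrite subr_eq0.
have [g hg] := vge_exprD (hasval1 M).1 vl.
rewrite /l addrCA subrr addr0 -/l ap !expr1n mulr1 => e.
have {}e : l ^+ p.-1 = - (p%:R * (1 + l * g)).
  apply: (mulfI l0); rewrite -exprS prednK //.
  apply/eqP; rewrite -subr_eq0; apply/eqP.
  transitivity (1 + l ^+ p + p%:R * l * (1 + l * g) - 1); first by ring.
  by rewrite -e subrr.
have vg : vge M (l * g) 0 by rewrite -(addr0 (0 : rat)); exact: vgeM.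
have l1 : vge M (l ^+ p.-1) 1.
  rewrite e; apply: vgeN; rewrite -(addr0 (1 : rat)); apply: vgeM.
    exact: (hasval_p M).1.
  by apply: vgeD => //; exact: (hasval1 M).1.
(* If [l] were a unit, [l ^+ p.-1] would have valuation 0, against [l1]. *)
have lgt : vgt M l 0.
  apply: vge_coef0_vgt => //; apply/eqP/negPn/negP => cl.
  by have := hasval_vge (@hasvalX _ _ _ _ p.-1 (conj vl cl)) l1; rewrite mul0r.
have gl : vgt M (l * g) 0.
  have [y y0 hy] := vgt_ex lgt.
  by apply: (@vgtW _ _ _ _ (y + 0)); [rewrite addr0 | exact: vgeM].
have : hasval (l ^+ p.-1) 1.
  rewrite e; apply: hasvalN; rewrite -[X in hasval _ X]addr0; apply: hasvalM.
    exact: hasval_p.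
  by apply: hasvalD => //; exact: hasval1.
have [y hy] := hasval_ex l0.
move=> /(hasval_uniq (@hasvalX _ _ _ _ p.-1 hy)) ey.
suff -> : r = y by [].
rewrite /r subn1; apply: (canLR (mulfK _)); last by rewrite ey.
by rewrite pnatr_eq0; lia.
Qed.

Variables (z : mnk M) (zeta : L).
Hypothesis z_pow : z ^+ (p - 1) = -1.

Definition rho : L := teich M z * ppow M (r / P).
Definition mu : L := rho ^+ p.

Lemma z_neq0 : z != 0.
Proof.
apply/eqP => z0; move: z_pow; rewrite z0 expr0n subn_eq0 leqNgt ltnW //=.
by move/esym/eqP; rewrite oppr_eq0 oner_eq0.
Qed.

Lemma hasval_rho : hasval rho (r / P).
Proof. by apply: hasval_mono; exact: z_neq0. Qed.

Lemma hasval_mu : hasval mu r.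
Proof. by have := @hasvalX _ _ _ _ p hasval_rho; rewrite vlamP. Qed.

Lemma teichN1 : teich M (-1) = -1.
Proof.
have /eqP : teich M (-1) ^+ 2 = 1 by rewrite -teichX sqrrN expr1n teich1.
rewrite sqrf_eq1 => /orP[/eqP h|/eqP//].
have := coef0_teich (-1 : mnk M); rewrite h mncoef1 eqxx => /eqP.
rewrite -addr_eq0 -[1 + 1]/(2%:R) natr_eq0 => /dvdn_leq h2; lia.
Qed.

Lemma muE : mu = - (teich M z * ppow M r).
Proof.
rewrite /mu /rho exprMn ppowX vlamP -teichX.
have -> : z ^+ p = -1 * z.
  by rewrite -z_pow -exprSr subn1 prednK //; lia.
by rewrite mn_teichM teichN1 mulN1r mulNr.
Qed.

Lemma mu_expr : mu ^+ (p - 1) = - p%:R.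
Proof.
have op : odd p by case: (even_prime (mn_prime M)) => // p2; move: p_gt2; rewrite p2.
have ep : ~~ odd (p - 1) by lia.
rewrite muE exprNn exprMn -teichX z_pow teichN1 ppowX.
rewrite -signr_odd (negbTE ep) expr0 mul1r mulN1r; congr (- _).
have -> : r * (p - 1)%:R = 1.
  by rewrite /r divfK // pnatr_eq0; lia.
exact: mn_ppow1.
Qed.

Hypothesis zeta_root : \sum_(k < p) zeta ^+ (p * k) = 0.
Hypothesis zeta_first : first_two_choices M zeta 1 z.

Lemma zeta_pp : (zeta ^+ p) ^+ p = 1.
Proof.
apply/eqP; rewrite -subr_eq0 subrX1.
under eq_bigr do rewrite -exprM.
by rewrite zeta_root mulr0.
Qed.

Lemma zeta_p_neq1 : zeta ^+ p != 1.
Proof.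
apply/eqP => h; move: zeta_root.
under eq_bigr do rewrite exprM h expr1n.
rewrite sumr_const card_ord => /eqP; rewrite natL_eq0; lia.
Qed.

Lemma hasval_zeta : hasval zeta 0.
Proof.
apply: (@hasval_unity_root _ (p * p)); last by rewrite exprM zeta_pp.
by rewrite muln_gt0; lia.
Qed.

Local Notation lam := (zeta ^+ p - 1).
Local Notation nu := (zeta - 1).

Lemma hasval_lam : hasval lam r.
Proof. exact: hasval_unity_root_sub1 zeta_pp zeta_p_neq1. Qed.

Lemma vlam_lt1 : r < 1.
Proof. have := vlam_le; have := vlam_gt0; lra. Qed.

Lemma vge_nu : vge M nu 0.
Proof. by apply: vgeB; [exact: hasval_zeta.1 | exact: (hasval1 M).1]. Qed.

(** [nu ^+ p] differs from [lam] by a multiple of [p], and [lam] has valuation [r < 1]. *)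
Lemma hasval_nu : hasval nu (r / P).
Proof.
have [g hg] := vge_exprD (hasval1 M).1 vge_nu.
rewrite addrCA subrr addr0 !expr1n mulr1 => e.
have nup : nu ^+ p = lam - p%:R * (nu * (1 + nu * g)) by rewrite e; ring.
have hnup : hasval (nu ^+ p) r.
  rewrite nup; apply: hasvalD; first exact: hasval_lam.
  apply: (vgtW vlam_lt1); apply: vgeN; rewrite -(addr0 (1 : rat)).
  apply: vgeM; first exact: (hasval_p M).1.
  apply/val_ringP; have /val_ringP ? := vge_nu; have /val_ringP ? := hg.
  by rewrite rpredM // rpredD ?rpred1 // rpredM.
have nu0 : nu != 0.
  by apply: contraTneq (hasval_neq0 hnup) => ->; rewrite expr0n gtn_eqF ?eqxx //; lia.
have [y hy] := hasval_ex nu0.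
have <- : y = r / P; last by [].
rewrite (hasval_uniq hnup (@hasvalX _ _ _ _ p hy)) mulfK //.
by rewrite pnatr_eq0; lia.
Qed.

(** The prescribed choices enter here: the first term 1 of [zeta] disappears in [nu], so the second
    one, with coefficient [z], is the leading term and must sit at the known valuation [r / p]. *)
Lemma vgt_nu_rho : vgt M (nu - rho) (r / P).
Proof.
have [x0 [x1 [x01 c0 c1 h0 h1]]] := zeta_first.
have ex0 : x0 = 0.
  have h : hasval zeta x0 by split; rewrite ?c0 ?oner_eq0.
  exact: hasval_uniq h hasval_zeta.
rewrite {x0}ex0 in x01 c0 h0 h1.
have [v1 e1] : vge M nu x1 /\ coef M x1 nu = coef M x1 zeta - coef M x1 1.
  apply: mn_agree => y yx1; rewrite mncoef1.
  case: (ltgtP y 0) => [y0|y0|->]; [exact: h0 | exact: h1 | exact: c0].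
rewrite c1 mncoef1 gt_eqF // subr0 in e1.
have hx1 : hasval nu x1 by split; rewrite ?e1 ?z_neq0.
have ex1 := hasval_uniq hx1 hasval_nu; rewrite {x1 c1 h1 x01}ex1 in v1 e1 hx1 *.
apply: vge_coef0_vgt; first by apply: vgeB => //; exact: hasval_rho.1.
by rewrite mncoefB ?e1 ?mn_mono ?eqxx ?subrr //; exact: hasval_rho.1.
Qed.

(** The margin between [nu] and [rho] survives [p]-th powers. This singles out [zeta ^+ p] among the
    [p]-th roots of unity. *)
Lemma vgt_lam_mu : vgt M (lam - mu) r.
Proof.
have [y hy eta] := vgt_ex vgt_nu_rho.
have q0 := vlamP_gt0; have y0 : 0 <= y by lra.
have vr : vge M rho 0 by apply: vgeW hasval_rho.1; exact: ltW.
have [g hg e] := vge_exprD (hasval1 M).1 vge_nu.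
rewrite addrCA subrr addr0 !expr1n mulr1 in e.
have -> : lam - mu = (nu ^+ p - rho ^+ p) + p%:R * (nu * (1 + nu * g)).
  by rewrite e /mu; ring.
have h1 : vge M (p%:R * (nu * (1 + nu * g))) (1 + 0).
  apply: vgeM; first exact: (hasval_p M).1.
  apply/val_ringP; have /val_ringP ? := vge_nu; have /val_ringP ? := hg.
  by rewrite rpredM // rpredD ?rpred1 // rpredM.
have h2 := vge_frob vr eta y0.
have r1 := vlam_lt1.
have yp : r < y * P.
  by rewrite -{1}vlamP ltr_pM2r //; have := P_ge3; lra.
apply: (@vgtW _ _ _ _ (Num.min 1 (Num.min (1 + y) (y * P)))).
  by rewrite !lt_min r1 yp !andbT; lra.
apply: vgeD; first by apply: vgeW h2; rewrite ge_min lexx orbT.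
by apply: vgeW h1; rewrite addr0 ge_min lexx.
Qed.

(** * Comparison with the truncated exponential *)

Local Notation E := (exp_trunc M).

Lemma vge_exp_trunc_sub1 a t : vge M a t -> 0 <= t -> vge M (E.[a] - 1) t.
Proof.
move=> ha t0; rewrite horner_exp_trunc.
have p0 : (0 < p)%N by lia.
rewrite (bigD1 (Ordinal p0)) //= expr0 fact0 divr1 [X in X - _]addrC addrK.
apply: vge_sum => k k0; rewrite -(addr0 t); apply: vgeM.
  apply: vgeW (@vgeX _ _ _ _ k ha).
  rewrite -[X in X <= _]mulr1 ler_wpM2l // ler1n lt0n.
  by apply: contraNneq k0 => k0; apply/eqP/val_inj.
exact: (hasval_invfact M (ltn_ord k)).1.
Qed.

Lemma vge_exp_trunc_sub1D a t : vge M a t -> 0 <= t -> vge M (E.[a] - 1 - a) (t + t).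
Proof.
move=> ha t0; rewrite horner_exp_trunc.
have p0 : (0 < p)%N by lia.
have p1 : (1 < p)%N by lia.
rewrite (bigD1 (Ordinal p0)) //= (bigD1 (Ordinal p1)) //=.
rewrite expr0 fact0 expr1 factS fact0 muln1 !divr1.
set s := \sum_(i < p | _) _.
have -> : 1 + (a + s) - 1 - a = s by ring.
apply: vge_sum => k /andP[k0 k1]; rewrite -[t + t]addr0; apply: vgeM.
  apply: vgeW (@vgeX _ _ _ _ k ha).
  rewrite -mulr2n -[X in X <= _]mulr_natr ler_wpM2l // ler_nat.
  by case: k k0 k1 => [[|[|k]] hk].
exact: (hasval_invfact M (ltn_ord k)).1.
Qed.

(* [mu ^+ p = - p * mu] makes the terms of order [1 + r] of [E.[mu] ^+ p - 1] cancel. *)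
Lemma vge_exp_trunc_mu_expr : vge M (E.[mu] ^+ p - 1) (2 + r).
Proof.
have r0 := vlam_gt0; have rE := vlamE.
have p0 : (0 < p)%N by lia.
have p1 : (1 < p)%N by lia.
have le_rE : P * r <= 1 + r by rewrite rE.
have h := exp_trunc_expr hasval_mu.1 (ltW r0) le_rE.
have -> : 2 + r = 1 + P * r by rewrite rE addrA.
have mup : mu ^+ p = - (p%:R * mu).
  have -> : mu ^+ p = mu ^+ (p - 1).+1 by congr (_ ^+ _); lia.
  by rewrite exprSr mu_expr mulNr.
rewrite (bigD1 (Ordinal p0)) //= (bigD1 (Ordinal p1)) //= in h.
rewrite expr0 fact0 expr1 factS fact0 muln1 !divr1 expr1n mup in h.
set s := \sum_(i < p | _) _ in h.
have -> : E.[mu] ^+ p - 1 =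
   E.[mu] ^+ p - (1 + (- (p%:R * mu) + s)) - p%:R * mu + s by ring.
apply: vgeD => //; apply: vge_sum => k /andP[k0 k1].
have k2 : (2 <= k)%N.
  by case: k k0 k1 => [[|[|k]] hk].
have hk : vge M (mu ^+ k / k`!%:R) (r * k%:R + 0).
  apply: vgeM; first exact: (@vgeX _ _ _ _ k hasval_mu.1).
  exact: (hasval_invfact M (ltn_ord k)).1.
apply: vgeW (@vgeX _ _ _ _ p hk).
have : (2 : rat) <= k%:R by rewrite ler_nat.
rewrite addr0 mulrAC [r * _]mulrC rE; move: (k%:R : rat) => K K2.
have : (1 + r) * 2 <= (1 + r) * K by rewrite ler_pM2l //; lra.
lra.
Qed.

(** Both elements start with [1 + mu], so [d] has valuation above [r]. There the linear term of
    [(e + d) ^+ p - e ^+ p] dominates [d ^+ p], whence [1 + v(d) = v(e ^+ p - 1) >= 2 + r] for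
    nonzero [d]. *)
Lemma vge_zeta_p_exp : vge M (zeta ^+ p - E.[mu]) (1 + r).
Proof.
have r0 := vlam_gt0; have rE := vlamE.
set e := E.[mu]; set d := _ - e.
have e1 : vge M (e - 1) r := vge_exp_trunc_sub1 hasval_mu.1 (ltW r0).
have he : hasval e 0.
  rewrite -(subrK 1 e) addrC; apply: hasvalD; first exact: hasval1.
  exact: vgtW r0 e1.
have hd : vgt M d r.
  have -> : d = (lam - mu) - (e - 1 - mu) by rewrite /d; ring.
  have [y ry hy] := vgt_ex vgt_lam_mu.
  have h2 := vge_exp_trunc_sub1D hasval_mu.1 (ltW r0).
  apply: (@vgtW _ _ _ _ (Num.min y (r + r))); first by rewrite lt_min ry; lra.
  apply: vgeB; first by apply: vgeW hy; rewrite ge_min lexx.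
  by apply: vgeW h2; rewrite ge_min lexx orbT.
have vd0 : vge M d 0 by apply: vgeW (vgt_vge hd); exact: ltW.
have [g hg] := vge_exprD he.1 vd0.
rewrite {1}/d addrCA subrr addr0 zeta_pp => eq1.
have eU : p%:R * e * d * (e ^+ (p - 2) + d * g) + d ^+ p = - (e ^+ p - 1).
  by rewrite [in RHS]eq1; ring.
apply: vgeP => y hy; have ry := hasval_vgt hy hd.
have hU : hasval (e ^+ (p - 2) + d * g) 0.
  apply: hasvalD; first by have := @hasvalX _ _ _ _ (p - 2) he; rewrite mul0r.
  by apply: (vgtW r0); rewrite -(addr0 r); apply: vgeM => //; exact: vgt_vge.
have hsum : hasval (p%:R * e * d * (e ^+ (p - 2) + d * g) + d ^+ p) (1 + 0 + y + 0).
  apply: hasvalD.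
    by apply: hasvalM => //; apply: hasvalM => //; apply: hasvalM => //; exact: hasval_p.
  apply: vgtW (@hasvalX _ _ _ _ p hy).1.
  have : (P - 1) * r < (P - 1) * y by rewrite ltr_pM2l //; have := P_ge3; lra.
  rewrite !mulrBl rE mul1r; lra.
have := hasval_vge hsum; rewrite eU => /(_ _ (vgeN vge_exp_trunc_mu_expr)); lra.
Qed.

(** * Partial sums of the expansion and their error *)

Definition tterm (l : nat) : L := teich M z * ppow M (1 / (p - 1)%:R - 1 / (p ^ l)%:R).

Lemma hasval_tterm l : hasval (tterm l) (r - 1 / (p ^ l)%:R).
Proof. by apply: hasval_mono; exact: z_neq0. Qed.

Lemma tterm1 : tterm 1 = rho.
Proof.
rewrite /tterm /rho expn1; congr (_ * ppow M _).
rewrite -/r; have P0 : P != 0 by have := P_ge3; lra.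
by apply: (mulIf P0); rewrite mulrBl !divfK // mulrC vlamE; ring.
Qed.

Lemma tterm_expr l : tterm l.+1 ^+ p = - (p%:R * tterm l).
Proof.
rewrite /tterm exprMn ppowX -teichX.
have -> : z ^+ p = -1 * z.
  by rewrite -z_pow -exprSr subn1 prednK //; lia.
have P0 : P != 0 by have := P_ge3; lra.
have -> : (1 / (p - 1)%:R - 1 / (p ^ l.+1)%:R) * P
   = 1 + (1 / (p - 1)%:R - 1 / (p ^ l)%:R) :> rat.
  rewrite -/r mulrBl mulrC vlamE expnS natrM.
  have Pl : (p ^ l)%:R != 0 :> rat by rewrite pnatr_eq0 expn_eq0; lia.
  by field; rewrite P0 Pl.
by rewrite mn_teichM teichN1 mn_ppowD mn_ppow1; ring.
Qed.

Lemma S1E : S1 M z = \sum_(k < p) rho ^+ k / teich M k`!%:R.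
Proof.
apply: eq_bigr => k _; rewrite /rho exprMn ppowX -mulrA mulrC.
congr (_ * ppow M _ / _).
rewrite /r natrM; have := P_ge3 => P3.
have n0 : ((p - 1)%:R : rat) != 0 by rewrite predP; lra.
by field; rewrite n0 andbT; lra.
Qed.

Lemma hasval_teich_fact k : (k < p)%N -> hasval (teich M k`!%:R) 0.
Proof.
by move=> kp; apply: hasval_teich; rewrite natr_eq0 prime_dvdn_fact ?(mn_prime M) // -ltnNge.
Qed.

Lemma vge_rho0 : vge M rho 0.
Proof. by apply: vgeW hasval_rho.1; exact/ltW/vlamP_gt0. Qed.

(** The factorials and their Teichmueller lifts agree modulo [p], and both are units for [k < p]. *)
Lemma vge_S1_exp : vge M (S1 M z - E.[rho]) 1.
Proof.
rewrite S1E horner_exp_trunc -sumrB; apply: vge_sum => k _.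
have hf := hasval_fact M (ltn_ord k); have ht := hasval_teich_fact (ltn_ord k).
have -> : rho ^+ k / teich M k`!%:R - rho ^+ k / k`!%:R =
   - (rho ^+ k * (teich M k`!%:R - k`!%:R)) / (teich M k`!%:R * k`!%:R).
  by field; rewrite (hasval_neq0 hf) (hasval_neq0 ht).
rewrite -(subr0 (1 : rat)); apply: vge_div; last by rewrite -(addr0 (0 : rat)); exact: hasvalM.
apply: vgeN; rewrite -(add0r (1 : rat)); apply: vgeM; last exact: (teich_nat M _).2.
by apply/val_ringP; rewrite rpredX //; apply/val_ringP; exact: vge_rho0.
Qed.

Lemma vge_exp_rho : vge M E.[rho] 0.
Proof.
rewrite -(subrK 1 E.[rho]); apply: vgeD; last exact: (hasval1 M).1.
have q0 := vlamP_gt0.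
by apply: vgeW (vge_exp_trunc_sub1 hasval_rho.1 _); exact: ltW.
Qed.

Lemma vge_S1_sub1 : vge M (S1 M z - 1) (r / P).
Proof.
have q0 := vlamP_gt0; have r1 := vlam_lt1.
have q1 : r / P <= 1.
  rewrite ler_pdivrMr; last by have := P_ge3; lra.
  by have := P_ge3; lra.
rewrite -(subrK E.[rho] (S1 M z)) -addrA; apply: vgeD.
  exact: vgeW vge_S1_exp.
by apply: vge_exp_trunc_sub1; [exact: hasval_rho.1 | exact: ltW].
Qed.

(** A chain of estimates, each of precision at least [1 + r]: [S1] to the [p] against [E.[rho] ^+
    p], this against [s + p * rho] with [s] the sum of [p]-th powers, [s] against [E.[mu]], and
    [E.[mu]] against [zeta ^+ p]. *)
Lemma vge_zeta_S1 : vge M (zeta ^+ p - S1 M z ^+ p + p%:R * rho) (1 + r).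
Proof.
have q0 := vlamP_gt0; have r0 := vlam_gt0; have r1 := vlam_lt1; have P3 := P_ge3.
have h1 := vge_frob vge_exp_rho vge_S1_exp ler01.
have h2 : vge M _ (1 + P * (r / P)) :=
  exp_trunc_expr hasval_rho.1 (ltW q0) _.
rewrite [P * (r / P)]mulrC vlamP in h2.
have {}h2 := h2 ltac:(lra).
set s := \sum_(k < p) _ in h2.
have h3 : vge M (s - E.[mu]) (1 + r).
  rewrite /s horner_exp_trunc -sumrB; apply: vge_sum => k _.
  have hf := hasval_fact M (ltn_ord k).
  have hfp : hasval ((k`!%:R : L) ^+ p) 0 by have := @hasvalX _ _ _ _ p hf; rewrite mul0r.
  have -> : (rho ^+ k / k`!%:R) ^+ p - mu ^+ k / k`!%:R =
     - (mu ^+ k * (k`!%:R ^+ p - k`!%:R)) / (k`!%:R ^+ p * k`!%:R).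
    rewrite exprMn exprVn -exprM mulnC exprM -/mu.
    move: (hasval_neq0 hf) (hasval_neq0 hfp).
    move: (k`!%:R ^+ p : L) (mu ^+ k) => u v hk hp.
    by field; rewrite hp hk.
  rewrite -(subr0 (1 + r)); apply: vge_div; last by rewrite -(addr0 (0 : rat)); exact: hasvalM.
  apply: vgeN.
  (* [mu ^+ 0] has no positive valuation, but then the other factor vanishes; for [k > 0], [mu ^+ k]
     supplies [r] and Fermat's congruence supplies 1. *)
  case: (posnP k) => [->|k0].
    by rewrite fact0 expr1n subrr mulr0; exact: vge0.
  rewrite [1 + r]addrC; apply: vgeM.
    apply: vgeW (@vgeX _ _ _ _ k hasval_mu.1).
    by rewrite -[X in X <= _]mulr1 ler_pM2l // ler1n.
  have [hQ ht] := teich_nat M k`!.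
  set b := teich M _ in hQ ht; set a : L := k`!%:R.
  have bp : b ^+ p = b.
    by rewrite -teichX -(pFrobenius_autE (mn_chark M)) rmorph_nat.
  (* Fermat's congruence through the lift [b], which is fixed by the [p]-th power and congruent to
     [a] modulo [p]. *)
  have -> : a ^+ p - a = (a ^+ p - b ^+ p) + (b - a) by rewrite bp; ring.
  apply: vgeD => //.
  have ht' : vge M (a - b) 1 by rewrite -opprB; exact: vgeN.
  apply: vgeW (vge_frob (vge_teich _) ht' ler01).
  by rewrite le_min; apply/andP; split; lra.
have h4 := vge_zeta_p_exp.
have -> : zeta ^+ p - S1 M z ^+ p + p%:R * rho =
  (zeta ^+ p - E.[mu]) - (s - E.[mu]) - (E.[rho] ^+ p - s - p%:R * rho)
   - (S1 M z ^+ p - E.[rho] ^+ p) by ring.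
apply: vgeB; last by apply: vgeW h1; rewrite le_min; apply/andP; split; lra.
by apply: vgeB => //; apply: vgeB.
Qed.

Definition Tsum (m : nat) : L := S1 M z + \sum_(2 <= l < m.+1) tterm l.

Lemma invp_pow_le l : (2 <= l)%N -> 1 / (p ^ l)%:R <= 1 / P * (1 / P).
Proof.
move=> l2; have P3 := P_ge3.
rewrite !mul1r -invfM -expr2 -natrX lef_pV2 ?posrE ?ltr0n ?expn_gt0; try lia.
by rewrite ler_nat leq_pexp2l //; lia.
Qed.

Lemma invp_pow_vlam l : (2 <= l)%N -> 1 / (p ^ l)%:R <= r / P.
Proof.
move=> /invp_pow_le h; apply: le_trans h _; rewrite {2}mul1r.
have P3 := P_ge3; rewrite ler_pM2r ?invr_gt0; last by lra.
rewrite ler_pdivrMr; last by lra.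
by rewrite mulrC vlamE; have := vlam_gt0; lra.
Qed.

Lemma vge_tterm l : (2 <= l)%N -> vge M (tterm l) (r - r / P).
Proof.
move=> l2; apply: vgeW (hasval_tterm l).1; rewrite lerD2l lerN2.
exact: invp_pow_vlam.
Qed.

Lemma vlamP_le : r / P + r / P <= r.
Proof.
have P3 := P_ge3; have q0 := vlamP_gt0; have := vlamP; set q := r / P.
move=> qP; have : q * 2 <= q * P by rewrite ler_pM2l //; lra.
by rewrite qP; lra.
Qed.

Lemma vge_Tsum_sub1 m : vge M (Tsum m - 1) (r / P).
Proof.
rewrite /Tsum addrAC; apply: vgeD; first exact: vge_S1_sub1.
rewrite big_nat_cond; apply: vge_sum => l /andP[/andP[l2 _] _].
by apply: vgeW (vge_tterm l2); have := vlamP_le; lra.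
Qed.

Lemma vge_Tsum m : vge M (Tsum m) 0.
Proof.
rewrite -(subrK 1 (Tsum m)); apply: vgeD; last exact: (hasval1 M).1.
by apply: vgeW (vge_Tsum_sub1 m); exact/ltW/vlamP_gt0.
Qed.

(** In the induction step the [p]-th power of the new term [t] is [- p] times the previous term and
    absorbs the old defect. The linear cross term [p * t * T ^+ (p - 1)] leaves the new defect
    [p * t], as [T] is close enough to 1. *)
Lemma vge_zeta_Tsum m : (0 < m)%N ->
  vge M (zeta ^+ p - Tsum m ^+ p + p%:R * tterm m) (1 + r).
Proof.
elim: m => // -[_ _|m IH _].
  by rewrite /Tsum big_geq // addr0 tterm1; exact: vge_zeta_S1.
have {}IH := IH isT.
have q0 := vlamP_gt0; have qr := vlamP_le.
have TE : Tsum m.+2 = Tsum m.+1 + tterm m.+2.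
  by rewrite /Tsum big_nat_recr //= addrA.
have vt := @vge_tterm m.+2 isT.
have vt0 : vge M (tterm m.+2) 0 by apply: vgeW vt; lra.
have [g hg] := vge_exprD (vge_Tsum m.+1) vt0.
rewrite TE => ->; rewrite tterm_expr; set T := Tsum m.+1 in IH *; set t := tterm m.+2 in vt vt0 *.
have Tp : T * T ^+ (p - 2) = T ^+ (p - 1) by rewrite -exprS; congr (_ ^+ _); lia.
have -> : zeta ^+ p - (T ^+ p + - (p%:R * tterm m.+1) +
    p%:R * T * t * (T ^+ (p - 2) + t * g)) + p%:R * t
  = (zeta ^+ p - T ^+ p + p%:R * tterm m.+1) - p%:R * (t * (T ^+ (p - 1) - 1))
    - p%:R * (t * t * (T * g)) by rewrite -Tp; ring.
have T1 : vge M (T ^+ (p - 1) - 1) (r / P).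
  rewrite subrX1 -(addr0 (r / P)); apply: vgeM; first exact: vge_Tsum_sub1.
  by apply/val_ringP; rewrite rpred_sum // => i _; rewrite rpredX //; apply/val_ringP; exact: vge_Tsum.
have Tg : vge M (T * g) 0 by rewrite -(addr0 (0 : rat)); apply: vgeM => //; exact: vge_Tsum.
apply: vgeB; last first.
  apply: vgeM; first exact: (hasval_p M).1.
  apply: vgeW (vgeM (vgeM vt vt) Tg); lra.
apply: vgeB => //; apply: vgeM; first exact: (hasval_p M).1.
by apply: vgeW (vgeM vt T1); lra.
Qed.

(** The error [d] satisfies [d ^+ p + p * d * (T * G) = - p * tterm m] up to valuation [1 + r], and
    the right side has valuation [1 + r - 1 / p ^ m], just below that bound. *)
Lemma hasval_zeta_sub_Tsum m : (0 < m)%N ->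
  hasval (zeta - Tsum m) (r - 1 / (p ^ m.+1)%:R).
Proof.
move=> m0; have D := vge_zeta_Tsum m0; have P3 := P_ge3.
have r0 := vlam_gt0; have rE := vlamE.
set d := zeta - _.
have vd : vge M d 0 by apply: vgeB; [exact: hasval_zeta.1 | exact: vge_Tsum].
have [g hg] := vge_exprD (vge_Tsum m) vd.
rewrite {1}/d addrCA subrr addr0; set T := Tsum m in D d vd *.
set G := T ^+ (p - 2) + d * g => e.
have vG : vge M (T * G) 0.
  have /val_ringP ? := vge_Tsum m; have /val_ringP ? := hg; have /val_ringP ? := vd.
  by apply/val_ringP; rewrite rpredM // rpredD ?rpredX // rpredM.
have eD : d ^+ p + p%:R * (d * (T * G)) =
  - (p%:R * tterm m) + (zeta ^+ p - T ^+ p + p%:R * tterm m) by rewrite e; ring.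
have Pm0 : 0 < 1 / (p ^ m)%:R :> rat by rewrite divr_gt0 // ltr0n expn_gt0; lia.
have hD : hasval (d ^+ p + p%:R * (d * (T * G))) (1 + (r - 1 / (p ^ m)%:R)).
  rewrite eD; apply: hasvalD.
    apply: hasvalN; apply: hasvalM; [exact: hasval_p | exact: hasval_tterm].
  by apply: vgtW D; lra.
have d0 : d != 0.
  apply: contraTneq (hasval_neq0 hD) => ->; rewrite mul0r mulr0 addr0 expr0n gtn_eqF ?eqxx //; lia.
have [y hy] := hasval_ex d0.
have hdp := @hasvalX _ _ _ _ p hy.
(* If [v(d) >= r], both terms on the left reach [1 + r], which is too much; so [v(d) < r], [d ^+ p]
   dominates, and [v(d)] is the total valuation divided by [p]. *)
have [ry|yr] := leP r y.
  have : vge M (d ^+ p + p%:R * (d * (T * G))) (1 + r).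
    apply: vgeD.
      by apply: vgeW hdp.1; rewrite -rE mulrC ler_pM2r //; lra.
    apply: vgeW (vgeM (hasval_p M).1 (vgeM hy.1 vG)); lra.
  by move=> /(hasval_vge hD); lra.
have hD2 : hasval (d ^+ p + p%:R * (d * (T * G))) (y * P).
  apply: hasvalD => //; apply: vgtW (vgeM (hasval_p M).1 (vgeM hy.1 vG)).
  have : (P - 1) * y < (P - 1) * r by rewrite ltr_pM2l //; lra.
  rewrite !mulrBl rE mul1r; lra.
have ey := hasval_uniq hD2 hD.
suff -> : r - 1 / (p ^ m.+1)%:R = y by [].
have P0 : P != 0 by lra.
apply: (mulIf P0); rewrite ey mulrBl mulrC rE expnS natrM.
have Pl : (p ^ m)%:R != 0 :> rat by rewrite pnatr_eq0 expn_eq0; lia.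
by field; rewrite P0 Pl.
Qed.

End RootsOfUnity.

(** * Finite extensions of Q_p *)

(** The coordinate matrix has more rows than columns, hence a nonzero left kernel vector. *)
Lemma linear_dependence (F L : fieldType) (f : {rmorphism F -> L}) (I : finType)
    (v : I -> L) (m : nat) (x : 'I_m -> L) : (#|I| < m)%N ->
  (forall k, exists c : I -> F, x k = \sum_i f (c i) * v i) ->
  exists2 u : 'I_m -> F, (exists k, u k != 0) & \sum_k f (u k) * x k = 0.
Proof.
move=> Im /choice[c xE].
pose A := \matrix_(k < m, j < #|I|) c k (enum_val j).
have : kermx A != 0.
  rewrite -mxrank_eq0 mxrank_ker subn_eq0 -ltnNge.
  by apply: leq_ltn_trans (rank_leq_col _) Im.
case/rowV0Pn => u /sub_kermxP uA u0; exists (fun k => u 0 k).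
  have [k hk] := rV0Pn _ u0; by exists k.
under eq_bigr do rewrite xE mulr_sumr.
rewrite exchange_big big1 // => i _.
have /matrixP/(_ 0 (enum_rank i)) := uA; rewrite !mxE => ui.
under eq_bigr do rewrite mulrA -rmorphM.
rewrite -mulr_suml -rmorph_sum /=.
have -> : \sum_k u 0 k * c k i = 0.
  by rewrite -[RHS]ui; apply: eq_bigr => k _; rewrite mxE enum_rankK.
by rewrite rmorph0 mul0r.
Qed.

(** Factors ['X] are stripped from [U] until its constant term [c] is nonzero; the relation then
    reads [x] times a polynomial in [x] equals [- f c]. *)
Lemma inv_algebraic (F L : fieldType) (f : {rmorphism F -> L}) (x : L)
    (U : {poly F}) : x != 0 -> U != 0 -> (map_poly f U).[x] = 0 ->
  exists W : {poly F}, x^-1 = (map_poly f W).[x].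
Proof.
move=> x0; elim/poly_ind: U => [|U c IH]; first by rewrite eqxx.
have [->|c0] := eqVneq c 0.
  rewrite addr0 mulf_eq0 polyX_eq0 orbF => U0.
  rewrite rmorphM /= map_polyX hornerM hornerX => /eqP.
  by rewrite mulf_eq0 (negbTE x0) orbF => /eqP; exact: IH.
move=> _; rewrite rmorphD rmorphM /= map_polyX map_polyC hornerD hornerM hornerX hornerC.
move=> e; exists (- c^-1 *: U).
rewrite map_polyZ hornerZ rmorphN fmorphV.
have fc0 : f c != 0 by rewrite fmorph_eq0.
have -> : (map_poly f U).[x] = - f c / x.
  apply: (mulIf x0); rewrite divfK //; apply/eqP; by rewrite -addr_eq0 e.
by field; rewrite x0 fc0.
Qed.

Lemma fracB_nint (e i j : nat) : (i < e)%N -> (j < e)%N -> i != j ->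
  (e%:R^-1 * i%:R - e%:R^-1 * j%:R : rat) \isn't a Num.int.
Proof.
move=> ie je ij; rewrite -mulrBr; apply/negP => /intrP[k hk].
have eQ : (e%:R : rat) != 0 by rewrite pnatr_eq0; lia.
have {}hk : (i%:R - j%:R : rat) = e%:R * k%:~R by rewrite -hk mulVKf.
have {}hk : (i%:Z - j%:Z = e%:Z * k).
  by apply: (@intr_inj rat); rewrite rmorphB rmorphM.
have [k0|[k0|k0]] : k = 0 \/ (k <= -1 \/ 1 <= k) by lia.
- by move: hk; rewrite k0 mulr0; lia.
- by nia.
- by nia.
Qed.

Section Spans.
Variables (p : nat) (M : MNfield p).
Local Notation L := (mnL M).
Local Notation Qp := (Qp M).
Local Notation Qp_val := (Qp_val M).
Implicit Types (a b c : L) (x y t : rat) (n : nat).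

(* Terms whose valuations are distinct modulo the value group of Q_p cannot
   cancel. *)
Lemma vge_sum_distinct (I : finType) (u : I -> Qp) (w : I -> L) (v : I -> rat) t :
  (forall i, hasval (w i) (v i)) ->
  (forall i j, i != j -> v i - v j \isn't a Num.int) ->
  vge M (\sum_i Qp_val (u i) * w i) t -> forall i, vge M (Qp_val (u i) * w i) t.
Proof.
move=> hw hv hs i; apply: vgeP => y hy; rewrite leNgt; apply/negP => yt.
pose term k := Qp_val (u k) * w k.
have valT k : exists s, term k != 0 -> hasval (term k) s.
  have [->|/hasval_ex[s hs']] := eqVneq (term k) 0; first by exists 0.
  by exists s.
have [s hsv] := choice valT.
have ti : term i != 0 := hasval_neq0 hy.
(* At the smallest valuation among nonzero terms nothing cancels: a second term of the same
   valuation would make [v k - v j] an integer, scalars from Q_p having integral valuation. *)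
have [j tj jmin] := @Order.TotalTheory.arg_minP _ _ _ i (fun k => term k != 0) s ti.
have sjt : s j < t.
  by apply: le_lt_trans (jmin _ ti) _; rewrite (hasval_uniq (hsv _ ti) hy).
have ge k : vge M (term k) (s j).
  have [->|tk] := eqVneq (term k) 0; first exact: vge0.
  exact: vgeW (jmin _ tk) (hsv _ tk).1.
have sE k : term k != 0 -> s k - v k \is a Num.int.
  move=> tk; apply: (@in_Qp_val_int _ M (Qp_val (u k))); first exact: iota_in.
  have -> : Qp_val (u k) = term k / w k by rewrite /term mulfK // (hasval_neq0 (hw k)).
  exact: hasval_div (hsv _ tk) (hw k).
have := hs _ sjt; rewrite mncoef_sum; last by move=> k _; exact: ge.
rewrite (bigD1 j) //= big1 ?addr0 => [/eqP|k kj].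
  by rewrite (negbTE (hsv _ tj).2).
have [tk0|tk] := eqVneq (term k) 0; first by rewrite -/(term k) tk0 mncoef0.
apply: (hsv _ tk).1; rewrite lt_neqAle (jmin _ tk) andbT.
apply: contraNneq (hv _ _ kj) => sjk.
have -> : v k - v j = (s j - v j) - (s k - v k) by rewrite sjk; ring.
by rewrite rpredB // sE.
Qed.

Definition evp (a : L) (U : {poly Qp}) : L := (map_poly Qp_val U).[a].

Lemma evpD a U V : evp a (U + V) = evp a U + evp a V.
Proof. by rewrite /evp rmorphD hornerD. Qed.

Lemma evpM a U V : evp a (U * V) = evp a U * evp a V.
Proof. by rewrite /evp rmorphM hornerM. Qed.

Lemma evpB a U V : evp a (U - V) = evp a U - evp a V.
Proof. by rewrite /evp rmorphB hornerD hornerN. Qed.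

Lemma evpC a (c : Qp) : evp a c%:P = Qp_val c.
Proof. by rewrite /evp map_polyC hornerC. Qed.

Lemma evp1 a : evp a 1 = 1.
Proof. by rewrite /evp rmorph1 hornerC. Qed.

Lemma evpX a : evp a 'X = a.
Proof. by rewrite /evp map_polyX hornerX. Qed.

Lemma evpXn a U n : evp a (U ^+ n) = evp a U ^+ n.
Proof. by rewrite /evp rmorphXn horner_exp. Qed.

Lemma evp_wide a (U : {poly Qp}) n : (size U <= n)%N -> evp a U = \sum_(i < n) Qp_val U`_i * a ^+ i.
Proof.
move=> h; rewrite /evp (horner_coef_wide _ (n := n)); last first.
  by rewrite size_map_poly.
by apply: eq_bigr => i _; rewrite coef_map.
Qed.

Lemma evp_reduce a (f U : {poly Qp}) n : f != 0 -> (size f <= n.+1)%N -> evp a f = 0 ->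
  exists2 V : {poly Qp}, (size V <= n)%N & evp a U = evp a V.
Proof.
move=> f0 sf fa; exists (U %% f); first by rewrite -ltnS (leq_trans _ sf) // ltn_modp.
by rewrite {1}(divp_eq U f) evpD evpM fa mulr0 add0r.
Qed.

Section Field.
Variables (nu theta : L) (f g : {poly Qp}) (n m : nat).
Hypothesis (f_neq0 : f != 0) (size_f : (size f <= n.+1)%N) (f_nu : evp nu f = 0).
Hypothesis (g_neq0 : g != 0) (size_g : (size g <= m.+1)%N) (g_theta : evp theta g = 0).

Definition ext_basis (i : 'I_n * 'I_m) : L := nu ^+ i.1 * theta ^+ i.2.

(** The Q_p-span of [n * m] monomials that may be dependent, so that it encodes only an upper bound
    on the degree. *)
Definition ext_field a := exists c : 'I_n * 'I_m -> Qp,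
  a = \sum_i Qp_val (c i) * ext_basis i.

Lemma ext0 : ext_field 0.
Proof. by exists (fun _ => 0); rewrite big1 // => i _; rewrite rmorph0 mul0r. Qed.

Lemma extD a b : ext_field a -> ext_field b -> ext_field (a + b).
Proof.
move=> [c ->] [d ->]; exists (fun i => c i + d i); rewrite -big_split.
by apply: eq_bigr => i _; rewrite rmorphD mulrDl.
Qed.

Lemma extZ (u : Qp) a : ext_field a -> ext_field (Qp_val u * a).
Proof.
move=> [c ->]; exists (fun i => u * c i); rewrite mulr_sumr.
by apply: eq_bigr => i _; rewrite rmorphM mulrA.
Qed.

Lemma ext_sum (I : Type) (s : seq I) (P : pred I) (F : I -> L) :
  (forall i, P i -> ext_field (F i)) -> ext_field (\sum_(i <- s | P i) F i).
Proof.
move=> h; apply: (big_ind ext_field) => //; first exact: ext0.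
exact: extD.
Qed.

Lemma ext_gen i : ext_field (ext_basis i).
Proof.
exists (fun j => (j == i)%:R); rewrite (bigD1 i) //= big1 ?addr0.
  by rewrite eqxx rmorph1 mul1r.
by move=> j /negbTE->; rewrite rmorph0 mul0r.
Qed.

(** Reduction of large exponents modulo [f] and [g]; this makes the span stable under products. *)
Lemma ext_monomial i j : ext_field (nu ^+ i * theta ^+ j).
Proof.
have [U sU eU] := evp_reduce 'X^i f_neq0 size_f f_nu.
have [V sV eV] := evp_reduce 'X^j g_neq0 size_g g_theta.
rewrite evpXn evpX (evp_wide _ sU) in eU; rewrite evpXn evpX (evp_wide _ sV) in eV.
rewrite eU eV mulr_suml; apply: ext_sum => k _; rewrite mulr_sumr; apply: ext_sum => l _.
have -> : Qp_val U`_k * nu ^+ k * (Qp_val V`_l * theta ^+ l) =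
   Qp_val U`_k * (Qp_val V`_l * ext_basis (k, l)) by rewrite /ext_basis /=; ring.
by do 2!apply: extZ; exact: ext_gen.
Qed.

Lemma extM a b : ext_field a -> ext_field b -> ext_field (a * b).
Proof.
move=> [c ->] [d ->]; rewrite mulr_suml; apply: ext_sum => i _.
rewrite mulr_sumr; apply: ext_sum => j _.
have -> : Qp_val (c i) * ext_basis i * (Qp_val (d j) * ext_basis j) =
  Qp_val (c i) * (Qp_val (d j) * (nu ^+ (i.1 + j.1) * theta ^+ (i.2 + j.2))).
  by rewrite /ext_basis !exprD; ring.
by do 2!apply: extZ; exact: ext_monomial.
Qed.

Lemma ext_Qp u : ext_field (Qp_val u).
Proof. by rewrite -[Qp_val u]mulr1; apply: extZ; have := ext_monomial 0 0; rewrite mulr1. Qed.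

Lemma ext1 : ext_field 1.
Proof. by have := ext_monomial 0 0; rewrite mulr1. Qed.

Lemma extX a i : ext_field a -> ext_field (a ^+ i).
Proof.
move=> ha; elim: i => [|i IH]; first exact: ext1.
by rewrite exprS; exact: extM.
Qed.

Lemma ext_dependent k (w : 'I_k -> L) : (n * m < k)%N -> (forall i, ext_field (w i)) ->
  exists2 u : 'I_k -> Qp, (exists i, u i != 0) & \sum_i Qp_val (u i) * w i = 0.
Proof.
by move=> nmk; apply: linear_dependence; rewrite card_prod !card_ord.
Qed.

(** The first [n * m + 1] powers of [a] are dependent, so [a] is algebraic over Q_p and its inverse
    is a polynomial in [a]. *)
Lemma extV a : ext_field a -> ext_field a^-1.
Proof.
have [->|a0] := eqVneq a 0; first by rewrite invr0.
move=> ha; have [|u [k uk] eu] := @ext_dependent (n * m).+1 (fun i => a ^+ i) (ltnSn _).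
  by move=> i; exact: extX.
pose U := \poly_(i < (n * m).+1) u (inord i).
have Ue : evp a U = 0.
  rewrite (evp_wide _ (size_poly _ _)) -[RHS]eu; apply: eq_bigr => i _.
  by rewrite coef_poly ltn_ord inord_val.
have U0 : U != 0.
  apply: contraNneq uk => U0; have := coef_poly (n * m).+1 (fun i => u (inord i)) k.
  by rewrite -/U U0 coef0 ltn_ord inord_val => <-.
have [W ->] := inv_algebraic a0 U0 Ue.
rewrite -/(evp a W) (evp_wide _ (leqnn _)); apply: ext_sum => i _.
by apply: extZ; exact: extX.
Qed.

Lemma extB a b : ext_field a -> ext_field b -> ext_field (a - b).
Proof.
move=> ha hb; apply: extD => //; have := extZ (-1) hb.
by rewrite rmorphN rmorph1 mulN1r.
Qed.

Lemma gen_field_ext (S : L -> Prop) :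
  (forall a, S a -> [\/ in_Qp M a, a = nu + 1 | a = theta]) ->
  forall a, gen_field M S a -> ext_field a.
Proof.
move=> hS a; apply; [|exact: ext1|exact: extB|exact: extM|exact: extV].
move=> b /hS[/in_Qp_iota[u <-]|->|->]; first exact: ext_Qp.
  by apply: extD; [have := ext_monomial 1 0; rewrite expr1 mulr1 | exact: ext1].
by have := ext_monomial 0 1; rewrite expr1 mul1r.
Qed.

(* An element with valuation outside (1/nm)Z would, together with the powers
   of [pi], give nm+1 elements with valuations distinct modulo Z in a Q_p-vector
   space of dimension at most nm. *)
Lemma ext_discrete pi a y : (0 < n * m)%N -> ext_field pi ->
  hasval pi (n * m)%:R^-1 -> ext_field a -> hasval a y ->
  y * (n * m)%:R \is a Num.int.
Proof.
set e := (n * m)%N => e0 Kpi hpi Ka hy; apply: contrapT => /negP ny.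
have eQ : (e%:R : rat) != 0 by rewrite pnatr_eq0 -lt0n.
(* The powers of [pi] fill the positions below [e], and [a] takes the last one. *)
pose w (i : 'I_e.+1) := if (i < e)%N then pi ^+ i else a.
pose v (i : 'I_e.+1) := if (i < e)%N then e%:R^-1 * i%:R else y.
have hw i : hasval (w i) (v i).
  by rewrite /w /v; case: ifP => _ //; exact: hasvalX.
have hv i j : i != j -> v i - v j \isn't a Num.int.
  have yj (k : nat) : y - e%:R^-1 * k%:R \isn't a Num.int.
    apply: contra ny => h.
    have -> : y * e%:R = (y - e%:R^-1 * k%:R) * e%:R + k%:R.
      by rewrite mulrBl mulrAC mulVf // mul1r subrK.
    by rewrite rpredD ?rpredM ?rpred_nat.
  rewrite /v; case: ltnP => hi; case: ltnP => hj ij.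
  - exact: fracB_nint.
  - by rewrite -rpredN opprB.
  - by [].
  - by case/eqP: ij; apply/val_inj; have := ltn_ord i; have := ltn_ord j; rewrite !ltnS /=; lia.
have Kw i : ext_field (w i) by rewrite /w; case: ifP => _ //; exact: extX.
have [u [k uk] eu] := ext_dependent (ltnSn _) Kw.
have : Qp_val (u k) * w k = 0.
  apply: vge_eq0 => N; apply: (vge_sum_distinct hw hv).
  by rewrite eu; exact: vge0.
move/eqP; rewrite mulf_eq0 fmorph_eq0 (negbTE uk) /=.
by rewrite (negbTE (hasval_neq0 (hw k))).
Qed.

End Field.

(** The powers of [nu] below [n] have valuations distinct modulo the integers, so approximations of
    [w] close to each other have close coefficients; these converge in Q_p to the coefficients of
    [w]. *)
Lemma span_closed (nu : L) n (w : L) : (0 < n)%N -> hasval nu n%:R^-1 ->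
  (forall t, exists2 U : {poly Qp}, (size U <= n)%N & vge M (w - evp nu U) t) ->
  exists U : {poly Qp}, w = evp nu U.
Proof.
move=> n0 hnu hw.
have nQ : (n%:R : rat) != 0 by rewrite pnatr_eq0 -lt0n.
(* One unit of precision is held in reserve, since dividing by [nu ^+ i] costs at most 1. *)
have /choice[U hU] : forall N : nat, exists V : {poly Qp},
    (size V <= n)%N /\ vge M (w - evp nu V) N.+1%:R.
  move=> N; have [V sV hV] := hw N.+1%:R; by exists V.
pose v (i : 'I_n) : rat := n%:R^-1 * i%:R.
have hv (i j : 'I_n) : i != j -> v i - v j \isn't a Num.int.
  by move=> ij; apply: fracB_nint.
have hpow (i : 'I_n) : hasval (nu ^+ i) (v i) by exact: hasvalX.
have v1 i : v i <= 1.
  by rewrite /v mulrC ler_pdivrMr ?ltr0n // mul1r ler_nat ltnW.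
have cauchy (i : 'I_n) N K : (N <= K)%N ->
    vge M (Qp_val (U N)`_i - Qp_val (U K)`_i) N%:R.
  move=> NK.
  have h : vge M (\sum_(j < n) Qp_val ((U N)`_j - (U K)`_j) * nu ^+ j) N.+1%:R.
    have -> : \sum_(j < n) Qp_val ((U N)`_j - (U K)`_j) * nu ^+ j
        = (w - evp nu (U K)) - (w - evp nu (U N)).
      rewrite (evp_wide _ (hU N).1) (evp_wide _ (hU K).1) opprB [RHS]addrC.
      rewrite addrA subrK -sumrB; apply: eq_bigr => j _.
      by rewrite rmorphB mulrBl.
    apply: vgeB; last exact: (hU N).2.
    by apply: vgeW (hU K).2; rewrite ler_nat.
  have {}h := vge_sum_distinct hpow hv h i.
  have := vge_div h (hpow i); rewrite mulfK ?(hasval_neq0 (hpow i)) // rmorphB.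
  by apply: vgeW; rewrite -natr1 -addrA lerDl subr_ge0.
have /choice[d hd] : forall i : 'I_n, exists u : Qp,
    forall N : nat, vge M (Qp_val (U N)`_i - Qp_val u) N%:R.
  move=> i; have [a ha] := mn_complete (cauchy i).
  suff /in_Qp_iota[u eu] : in_Qp M a by exists u => N; rewrite eu.
  apply/in_QpE => t; pose N := Num.bound `|t|.
  have tN : t <= N%:R by exact/ltW/lt_bound.
  have /in_QpE/(_ t)[b rb hb] := iota_in (U N)`_i.
  exists b => //; have -> : a - b = (Qp_val (U N)`_i - b) - (Qp_val (U N)`_i - a) by ring.
  by apply: vgeB => //; exact: vgeW (ha N).
exists (\poly_(i < n) (if insub i is Some j then d j else 0)).
apply/eqP; rewrite -subr_eq0; apply/eqP; apply: vge_eq0 => N.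
rewrite (evp_wide _ (size_poly _ _)).
rewrite -(subrK (evp nu (U N)) w) -addrA; apply: vgeD.
  by apply: vgeW (hU N).2; rewrite ler_nat.
rewrite (evp_wide _ (hU N).1) -sumrB; apply: vge_sum => i _.
rewrite coef_poly ltn_ord valK -mulrBl -[N%:R]addr0; apply: vgeM; first exact: hd.
by apply: vgeW (hpow i).1; rewrite /v mulr_ge0 ?invr_ge0 ?ler0n.
Qed.

End Spans.

(** * The fields K_(2,m) *)

Section GenField.
Variables (p : nat) (M : MNfield p) (S : mnL M -> Prop).
Local Notation L := (mnL M).
Local Notation K := (gen_field M S).
Implicit Types (a b : L).

Lemma gen_field_gen a : S a -> K a.
Proof. by move=> ha F FS _ _ _ _; exact: FS. Qed.

Lemma gen_field1 : K 1.
Proof. by move=> F. Qed.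

Lemma gen_fieldB a b : K a -> K b -> K (a - b).
Proof. by move=> ha hb F FS F1 FB FM FV; apply: (FB); [exact: (ha F FS F1 FB FM FV) | exact: (hb F FS F1 FB FM FV)]. Qed.

Lemma gen_fieldM a b : K a -> K b -> K (a * b).
Proof. by move=> ha hb F FS F1 FB FM FV; apply: (FM); [exact: (ha F FS F1 FB FM FV) | exact: (hb F FS F1 FB FM FV)]. Qed.

Lemma gen_fieldV a : K a -> K a^-1.
Proof. by move=> ha F FS F1 FB FM FV; apply: (FV); exact: (ha F FS F1 FB FM FV). Qed.

Lemma gen_fieldN a : K a -> K (- a).
Proof.
move=> ha; rewrite -sub0r -(subrr 1).
by apply: gen_fieldB => //; apply: gen_fieldB; exact: gen_field1.
Qed.

Lemma gen_fieldD a b : K a -> K b -> K (a + b).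
Proof. by move=> ha hb; rewrite -[b]opprK; apply: gen_fieldB => //; exact: gen_fieldN. Qed.

Lemma gen_fieldX a n : K a -> K (a ^+ n).
Proof.
move=> ha; elim: n => [|n IH]; first exact: gen_field1.
by rewrite exprS; exact: gen_fieldM.
Qed.

Lemma gen_field_sum (I : Type) (s : seq I) (P : pred I) (F : I -> L) :
  (forall i, P i -> K (F i)) -> K (\sum_(i <- s | P i) F i).
Proof.
move=> h; apply: (big_ind K) => //; last by move=> ? ?; exact: gen_fieldD.
by rewrite -(subrr 1); apply: gen_fieldB; exact: gen_field1.
Qed.

End GenField.

Section Main.
Variables (p : nat) (M : MNfield p).
Hypothesis p_gt2 : (2 < p)%N.
Variables (z : mnk M) (zeta : mnL M).
Hypothesis z_pow : z ^+ (p - 1) = -1.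
Hypothesis zeta_root : \sum_(k < p) zeta ^+ (p * k) = 0.
Hypothesis zeta_first : first_two_choices M zeta 1 z.
Local Notation L := (mnL M).
Local Notation P := (p%:R : rat).
Local Notation r := (vlam p).
Local Notation lam := (zeta ^+ p - 1).
Local Notation nu := (zeta - 1).
Local Notation mu := (mu z).
Local Notation Qp := (Qp M).
Local Notation Qp_val := (Qp_val M).
Local Notation deg := (p * (p - 1))%N.
Implicit Types (a b c : L) (x y t : rat) (n : nat).

Lemma vnuE : r / P = deg%:R^-1.
Proof. by rewrite /vlam natrM div1r invfM mulrC. Qed.

(** The polynomial [Phi_(p^2)(X + 1)], which annihilates [nu]. *)
Definition cyclo_shift : {poly Qp} := \sum_(k < p) ('X + 1) ^+ (p * k).

Lemma cyclo_shift_neq0 : cyclo_shift != 0.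
Proof.
apply/eqP => /(congr1 (fun U => U.[0])); rewrite horner0 horner_sum.
under eq_bigr do rewrite horner_exp hornerD hornerX hornerC add0r expr1n.
rewrite sumr_const card_ord => /(congr1 Qp_val) /eqP.
by rewrite rmorph_nat rmorph0 natL_eq0; lia.
Qed.

Lemma size_cyclo_shift : (size cyclo_shift <= deg.+1)%N.
Proof.
apply: leq_trans (size_sum _ _ _) _; apply/bigmax_leqP => k _.
apply: leq_trans (size_poly_exp_leq _ _) _.
rewrite -[1]opprK -polyCN size_XsubC /= mul1n ltnS leq_mul2l.
by have := ltn_ord k; lia.
Qed.

Lemma evp_X1 n : evp nu (('X + 1) ^+ n) = zeta ^+ n.
Proof. by rewrite evpXn evpD evpX evp1 subrK. Qed.

Lemma evp_cyclo_shift : evp nu cyclo_shift = 0.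
Proof.
rewrite /evp rmorph_sum horner_sum -[RHS]zeta_root; apply: eq_bigr => k _.
exact: evp_X1.
Qed.

Lemma near1M a b t : 0 <= t -> vge M (a - 1) t -> vge M (b - 1) t -> vge M (a * b - 1) t.
Proof.
move=> t0 ha hb; have -> : a * b - 1 = (a - 1) * (b - 1) + (a - 1) + (b - 1) by ring.
do 2!apply: vgeD => //; apply: (vgeW _ (vgeM ha hb)); lra.
Qed.

Lemma near1X a n t : 0 <= t -> vge M (a - 1) t -> vge M (a ^+ n - 1) t.
Proof.
move=> t0 ha; elim: n => [|n IH]; first by rewrite subrr; exact: vge0.
by rewrite exprS; exact: near1M.
Qed.

(* [lam / mu] is the limit of the iteration [y -> y - (y ^+ (p - 1) - w ^+ (p - 1)) / (p - 1)]
   started at 1, which stays in Q_p(nu) since [(lam / mu) ^+ (p - 1) = - lam ^+ (p - 1) / p]. *)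
Lemma lam_div_mu_in : exists U : {poly Qp}, lam / mu = evp nu U.
Proof.
set w := lam / mu; set q := (p - 1)%N.
have hmu := hasval_mu p_gt2 z_pow; have mu0 := hasval_neq0 hmu.
have deg0 : (0 < deg)%N by rewrite muln_gt0; lia.
have hq : hasval (q%:R : L) 0.
  by apply: hasval_nat_coprime; apply/negP => /dvdn_leq; rewrite /q; lia.
have q0 := hasval_neq0 hq.
have [W hW] : exists W : {poly Qp}, evp nu W = w ^+ q.
  exists ((('X + 1) ^+ p - 1) ^+ q * ((- p%:R)^-1)%:P).
  rewrite evpM evpXn evpB evp_X1 evp1 evpC.
  by rewrite fmorphV rmorphN rmorph_nat exprMn exprVn mu_expr.
have [c c0 hc] : exists2 c, 0 < c & vge M (w - 1) c.
  have [y ry hy] := vgt_ex (vgt_lam_mu p_gt2 z_pow zeta_root zeta_first).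
  exists (y - r); first by rewrite subr_gt0.
  have -> : w - 1 = (lam - mu) / mu by rewrite mulrBl divff.
  exact: vge_div hy hmu.
have step N : exists U : {poly Qp},
    vge M (evp nu U - w) (c * N.+1%:R) /\ vge M (evp nu U - 1) c.
  elim: N => [|N [U [h1 h2]]].
    exists 1; rewrite evp1 subrr mulr1; split; last exact: vge0.
    by rewrite -opprB; exact: vgeN.
  pose V := U - (U ^+ q - W) * ((q%:R)^-1)%:P.
  have VE : evp nu V = evp nu U - (evp nu U ^+ q - w ^+ q) / q%:R.
    by rewrite evpB evpM evpB evpXn hW evpC fmorphV rmorph_nat.
  set y := evp nu U in h1 h2 VE.
  have VN : vge M (evp nu V - w) (c * N.+2%:R).
    (* The second factor is a mean of elements [1 - y ^+ i * w ^+ j], which are small because [y]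
       and [w] are 1-units of level [c]; hence each step gains [c]. *)
    have -> : evp nu V - w =
       (y - w) * ((\sum_(i < q) (1 - y ^+ (q.-1 - i) * w ^+ i)) / q%:R).
      rewrite sumrB sumr_const card_ord VE subrXX.
      by move: (\sum_(i < q) _) (q%:R : L) q0 => s Q Q0; field.
    rewrite -[N.+2%:R]natr1 mulrDr mulr1; apply: vgeM => //.
    rewrite -(subr0 c); apply: vge_div => //; apply: vge_sum => i _.
    rewrite -opprB; apply: vgeN; have c0' := ltW c0.
    by apply: near1M => //; apply: near1X.
  exists V; split => //.
  have -> : evp nu V - 1 = (evp nu V - w) + (w - 1) by ring.
  apply: vgeD => //; apply: vgeW VN; rewrite -[X in X <= _]mulr1.
  by rewrite ler_pM2l // ler1n.
(* The iterates lie in Q_p(nu), and reducing them modulo [cyclo_shift] bounds their size by [deg],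
   so the limit stays in that field. *)
apply: (span_closed (n := deg)) => //.
  by rewrite -vnuE; exact: (hasval_nu p_gt2 zeta_root).
move=> t; pose N := Num.bound `|t / c|.
have [U [hU _]] := step N.
have [V sV eV] := evp_reduce U cyclo_shift_neq0 size_cyclo_shift evp_cyclo_shift.
exists V => //; rewrite -eV -opprB; apply: vgeN; apply: vgeW hU.
rewrite mulrC -ler_pdivrMr //; apply: le_trans (ltW (lt_bound _)) _.
by rewrite ler_nat.
Qed.

Variable m : nat.
Hypothesis m_gt0 : (0 < m)%N.
Local Notation theta := (ppow M (1 / (p ^ m)%:R)).
Local Notation K := (K2 M zeta m).

Lemma K2_zeta : K zeta.
Proof. by apply: gen_field_gen; right; left. Qed.

Lemma K2_theta : K theta.
Proof. by apply: gen_field_gen; right; right. Qed.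

Lemma K2_Qp a : in_Qp M a -> K a.
Proof. by move=> ha; apply: gen_field_gen; left. Qed.

Lemma K2_evp U : K (evp nu U).
Proof.
rewrite (evp_wide _ (leqnn _)); apply: gen_field_sum => i _.
apply: gen_fieldM; first by apply: K2_Qp; exact: iota_in.
by apply: gen_fieldX; apply: gen_fieldB; [exact: K2_zeta | exact: gen_field1].
Qed.

Lemma K2_mu : K mu.
Proof.
have [U eU] := lam_div_mu_in.
have hmu := hasval_mu p_gt2 z_pow; have mu0 := hasval_neq0 hmu.
have l0 := hasval_neq0 (hasval_lam p_gt2 zeta_root).
have -> : mu = lam / (lam / mu) by field; rewrite mu0.
apply: gen_fieldM; last by rewrite eU; apply: gen_fieldV; exact: K2_evp.
by apply: gen_fieldB; [apply: gen_fieldX; exact: K2_zeta | exact: gen_field1].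
Qed.

Lemma K2_tterm l : (0 < l <= m)%N -> K (tterm z l).
Proof.
move=> /andP[l0 lm]; rewrite /tterm mn_ppowD ppowN mulrA -/r.
have -> : teich M z * ppow M r = - mu by rewrite muE // opprK.
apply: gen_fieldM; first by apply: gen_fieldN; exact: K2_mu.
apply: gen_fieldV.
have -> : 1 / (p ^ l)%:R = 1 / (p ^ m)%:R * (p ^ (m - l))%:R :> rat.
  have n0 k : (p ^ k)%:R != 0 :> rat by rewrite pnatr_eq0 expn_eq0; lia.
  by rewrite -{1}(subnKC lm) expnD natrM; field; rewrite !n0.
by rewrite -ppowX; apply: gen_fieldX; exact: K2_theta.
Qed.

Lemma K2_Tsum : K (Tsum z m).
Proof.
apply: gen_fieldD; last first.
  rewrite big_nat_cond; apply: gen_field_sum => l /andP[/andP[l2 lm] _].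
  by apply: K2_tterm; lia.
rewrite S1E //; apply: gen_field_sum => k _; apply: gen_fieldM.
  (* [rho] is [tterm z 1], which is available because [m >= 1]. *)
  by apply: gen_fieldX; rewrite -(tterm1 p_gt2); apply: K2_tterm.
by apply: gen_fieldV; apply: K2_Qp; exact: (teich_nat M _).1.
Qed.

Lemma pi2mE : pi2m M z zeta m =
  theta ^- ((p ^ m - 1) %/ (p - 1)) * (zeta - Tsum z m).
Proof. by rewrite /pi2m /Tsum opprD addrA. Qed.

Lemma K2_pi2m : K (pi2m M z zeta m).
Proof.
rewrite pi2mE; apply: gen_fieldM.
  by apply: gen_fieldV; apply: gen_fieldX; exact: K2_theta.
by apply: gen_fieldB; [exact: K2_zeta | exact: K2_Tsum].
Qed.

Lemma hasval_pi2m : hasval (pi2m M z zeta m) (deg * p ^ m)%:R^-1.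
Proof.
set k := ((p ^ m - 1) %/ (p - 1))%N.
(* [p - 1] divides [p ^ m - 1], so the integer quotient is exact. *)
have kE : k%:R = ((p ^ m)%:R - 1) * r :> rat.
  have : (k * (p - 1) = p ^ m - 1)%N.
    by rewrite divnK // !subn1 predn_exp dvdn_mulr.
  move/(congr1 (fun i => i%:R : rat)).
  rewrite natrM [(p ^ m - 1)%:R]natrB; last by rewrite expn_gt0; lia.
  by move=> <-; rewrite /vlam mulrA mulr1 mulfK // pnatr_eq0; lia.
have P3 := P_ge3 p_gt2; have rE := vlamE p_gt2.
have Q0 : (p ^ m)%:R != 0 :> rat by rewrite pnatr_eq0 expn_eq0; lia.
have P0 : P != 0 by lra.
(* The right side is [r / p ^ m - 1 / p ^ m.+1 = (p * r - 1) / p ^ m.+1 = r / p ^ m.+1]. *)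
have -> : (deg * p ^ m)%:R^-1 =
    - (1 / (p ^ m)%:R * k%:R) + (r - 1 / (p ^ m.+1)%:R).
  rewrite natrM invfM -vnuE kE expnS natrM.
  have -> : r / P / (p ^ m)%:R = (P * r - 1) / P / (p ^ m)%:R.
    by rewrite rE addrC addrA addNr add0r.
  by field; rewrite P0 Q0.
rewrite pi2mE; apply: hasvalM.
  by apply: hasvalV; apply: hasvalX; exact: hasval_ppow.
exact: hasval_zeta_sub_Tsum.
Qed.

(** A nonzero element of [K] of positive valuation has valuation [i / (deg * p ^ m)] with [i >= 1],
    hence at least that of [pi]. *)
Lemma uniformizer_pi2m : uniformizer M K (pi2m M z zeta m).
Proof.
have hpi := hasval_pi2m; set pi := pi2m M z zeta m in hpi *.
have pm0 : (0 < p ^ m)%N by rewrite expn_gt0; lia.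
have e0 : (0 < deg * p ^ m)%N by rewrite muln_gt0 pm0 andbT muln_gt0; lia.
split; [exact: K2_pi2m | exact: hasval_neq0 hpi | | ].
  by apply: vgtW hpi.1; rewrite invr_gt0 ltr0n.
move=> a Ka a_gt0; have [->|/hasval_ex[y hy]] := eqVneq a 0.
  by rewrite mul0r; exact: vge0.
(* [g] annihilates [theta] and bounds its degree by [p ^ m], as [cyclo_shift] does for [nu] with
   [deg]. *)
pose g : {poly Qp} := 'X^(p ^ m) - p%:R%:P.
have size_g : size g = (p ^ m).+1 by rewrite size_XnsubC.
have g0 : g != 0 by rewrite -size_poly_eq0 size_g.
have evg : evp theta g = 0.
  rewrite evpB evpXn evpX evpC rmorph_nat ppowX div1r mulVf ?mn_ppow1 ?subrr //.
  by rewrite pnatr_eq0; lia.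
have sub b : K b -> ext_field nu theta deg (p ^ m) b.
  apply: (gen_field_ext cyclo_shift_neq0 size_cyclo_shift evp_cyclo_shift g0 _ evg).
    by rewrite size_g.
  move=> d [hd|[->|->]]; [exact: Or31 | by apply: Or32; rewrite subrK | exact: Or33].
have := ext_discrete cyclo_shift_neq0 size_cyclo_shift evp_cyclo_shift g0
  _ evg e0 (sub _ K2_pi2m) hpi (sub _ Ka) hy.
rewrite size_g => /(_ (leqnn _)) /intrP[i yi].
have y0 : 0 < y := hasval_vgt hy a_gt0.
have eQ : 0 < (deg * p ^ m)%:R :> rat by rewrite ltr0n.
have : 0 < y * (deg * p ^ m)%:R by rewrite mulr_gt0.
rewrite yi ltr0z => i0.
apply: vgeW (vge_div hy.1 hpi).
by rewrite subr_ge0 -div1r ler_pdivrMr // yi ler1z; lia.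
Qed.

End Main.

Theorem theorem3p25 (p : nat) (M : MNfield p) (z : mnk M) (zeta : mnL M) :
  prime p -> (2 < p)%N -> (2 * (p - 1)).-primitive_root z ->
  newton_root M (cyclo_p2 M) zeta -> first_two_choices M zeta 1 z ->
  uniformizer M (K2 M zeta 1) (pi21 M z zeta) /\
  (forall m : nat, (2 <= m)%N -> uniformizer M (K2 M zeta m) (pi2m M z zeta m)).
Proof.
move=> pr_p p_gt2 z_prim [f_zeta _] zeta_first.
(* The square of [z ^+ (p - 1)] is 1, and the order [2 * (p - 1)] of [z] excludes the value 1. *)
have z_pow : z ^+ (p - 1) = -1.
  have /eqP := prim_expr_order z_prim; rewrite mulnC exprM sqrf_eq1 => /orP[/eqP h|/eqP//].
  by have := prim_order_dvd z_prim (p - 1); rewrite h eqxx => /dvdn_leq; lia.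
have zeta_root : \sum_(k < p) zeta ^+ (p * k) = 0.
  rewrite -[RHS]f_zeta /cyclo_p2 horner_sum.
  by apply: eq_bigr => k _; rewrite hornerXn.
(* For [m = 1] the sum over [l] is empty and the exponent [(p - 1) %/ (p - 1)] is 1, so [pi2m]
   becomes [pi21]. *)
split=> [|m m2]; last by apply: uniformizer_pi2m => //; lia.
have := uniformizer_pi2m p_gt2 z_pow zeta_root zeta_first (ltnSn 0).
suff -> : pi2m M z zeta 1 = pi21 M z zeta by [].
by rewrite /pi2m /pi21 !expn1 divnn (big_geq (leqnn _)) subr0 subn_gt0 (ltnW p_gt2).
Qed.
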